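(* Let $l,m,n$ be positive integers such that $2\le m\le n$, $l\mid n$ and $l\le \min\{m-1,\frac n2\}$. Let $m\equiv s\pmod l$ with $0\le s<l$, put $t=\frac{m-s}{l}$ and $k=\frac nl$, and assume $t\ge 2$. Write $k=p(t+1)+d$ with integers $p\ge 0$ and $0\le d\le t$. Let $I_{m,l}(C_n)\subseteq R=K[x_1,\dots,x_n]$ be the path ideal of the $n$-cycle $C_n$. Then the graded Betti numbers of degree $n$ are $$\beta_{i,n}(R/I_{m,l}(C_n))=\begin{cases} t, & \text{if } d=0,\ i=2p,\\ 1, & \text{if } d\ne 0,\ i=2p+1,\\ 0, & \text{otherwise.}\end{cases}$$
   Context: $K$ is an arbitrary field and $R=K[x_1,\dots,x_n]$ with the standard grading. Indices of variables are read modulo $n$: $x_j=x_i$ whenever $j\equiv i \pmod n$, $1\le i\le n$. The path ideal is $$I_{m,l}(C_n)=\Big(\prod_{j=1}^m x_{(i-1)l+j} : 1\le i\le k\Big)\subseteq R.$$ $\beta_{i,j}(R/I)$ denotes the $(i,j)$-th graded Betti number of $R/I$, i.e. the number of copies of $R(-j)$ in homological degree $i$ of the minimal graded free resolution of $R/I$ over $R$. *)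

(* Defs.v *)
From HB Require Import structures.
From mathcomp Require Import all_boot all_order all_algebra.
From mathcomp Require Import mpoly.

Set Implicit Arguments.
Unset Strict Implicit.
Unset Printing Implicit Defensive.

Import GRing.Theory.
Local Open Scope ring_scope.

Definition ideal_span (R : comNzRingType) (T : finType) (g : T -> R) (p : R)
  : Prop :=
  exists c : T -> R, p = \sum_(i : T) c i * g i.

(* Variables are numbered from 0: the variable written x_a, with a read modulo
   n in {1, ..., n}, is ['X_(cycle_index n_gt0 (a - 1))]. *)
Definition cycle_index (n : nat) (n_gt0 : (0 < n)%N) (a : nat) : 'I_n :=
  Ordinal (ltn_pmod a n_gt0).

Definition path_monomial (K : fieldType) (n : nat) (n_gt0 : (0 < n)%N)
    (m l i : nat) : {mpoly K[n]} :=
  \prod_(j < m) 'X_(cycle_index n_gt0 (i * l + j)).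

Definition path_ideal (K : fieldType) (n : nat) (n_gt0 : (0 < n)%N)
    (m l : nat) : {mpoly K[n]} -> Prop :=
  ideal_span (fun i : 'I_(n %/ l) => path_monomial K n_gt0 m l i).

(* A sequence of finitely generated graded free modules
     ... -> F_2 -> F_1 -> F_0,   F_i = \bigoplus_(a < rank i) R(- shift i a),
   over R = K[x_1, ..., x_n], where F_i is the module of row vectors and the
   maps act by right multiplication, together with a map F_0 -> R, the column
   [aug], whose composite with R -> R/J is the augmentation F_0 -> R/J (every
   homogeneous map F_0 -> R/J arises in this way).  Natural number shifts are
   enough: a minimal generator in a resolution of R/J has degree >= 0. *)
Record graded_free_seq (K : fieldType) (n : nat) := GradedFreeSeq {
  rank  : nat -> nat;
  shift : forall i : nat, 'I_(rank i) -> nat;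
  diff  : forall i : nat, 'M[{mpoly K[n]}]_(rank i.+1, rank i);
  aug   : 'cV[{mpoly K[n]}]_(rank 0)
}.

(* The entry of F_(i+1) -> F_i at (a, b) must be homogeneous of degree
   [shift i.+1 a - shift i b] (hence zero when this is negative); writing this
   on monomials avoids a truncated subtraction.  Minimality is
   d(F_(i+1)) \subseteq (x_1, ..., x_n) F_i, that is, all entries of the
   matrices have zero constant coefficient. *)
Record minimal_graded_free_resolution (K : fieldType) (n : nat)
    (J : {mpoly K[n]} -> Prop) (F : graded_free_seq K n) : Prop := {
  aug_graded : forall a : 'I_(rank F 0),
    aug F a 0 \is (shift a).-homog;
  diff_graded : forall (i : nat) (a : 'I_(rank F i.+1)) (b : 'I_(rank F i))
      (u : 'X_{1..n}),
    u \in msupp (diff F i a b) -> (mdeg u + shift b)%N = shift a;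
  aug_surjective : forall q : {mpoly K[n]},
    exists v : 'rV[{mpoly K[n]}]_(rank F 0), J (q - (v *m aug F) 0 0);
  exact_zero : forall v : 'rV[{mpoly K[n]}]_(rank F 0),
    J ((v *m aug F) 0 0) <->
    exists w : 'rV[{mpoly K[n]}]_(rank F 1), v = w *m diff F 0;
  exact_succ : forall (i : nat) (v : 'rV[{mpoly K[n]}]_(rank F i.+1)),
    v *m diff F i = 0 <->
    exists w : 'rV[{mpoly K[n]}]_(rank F i.+2), v = w *m diff F i.+1;
  minimal : forall (i : nat) (a : 'I_(rank F i.+1)) (b : 'I_(rank F i)),
    (diff F i a b)@_0%MM = 0
}.

Definition graded_betti (K : fieldType) (n : nat) (F : graded_free_seq K n)
    (i j : nat) : nat :=
  #|[set a : 'I_(rank F i) | shift a == j]|.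

(* Main.v *)
From HB Require Import structures.
Require Import Defs.
From mathcomp Require Import all_boot all_order all_algebra zify.
From mathcomp Require Import mpoly.
From Stdlib Require Import IndefiniteDescription FunctionalExtensionality.

(** Any graded free resolution [G] of [R/J] determines the Betti numbers: the
    comparison maps between [G] and the minimal resolution are inverse to each
    other up to homotopy, and the minimal differentials vanish modulo the
    variables, so [beta_(i,j)] is the dimension of the homology in position [i]
    of the degree [j] part of [G] tensored with [K] ([strand_dim]).

    For a monomial ideal one may take [G] to be the Taylor complex
    ([taylor_resolution]), whose basis elements are the sets [S] of generators,
    with the degree of the lcm of [S] as shift.  All the generators of a path
    ideal are squarefree, so the lcm of [S] has degree [n] exactly when the paths
    in [S] cover the cycle.  The cycle consists of [k] blocks of [l] vertices, and
    the last vertex of a block lies on the [i]-th path only if that block is one of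
    [i, ..., i + t - 1], and these blocks lie on it entirely; hence covering means
    that [S], viewed in Z/k, meets every interval of [t] consecutive residues
    ([mdeg_mlcm_good]).  The remaining problem is the homology of the complex of
    these [good] sets, where the boundary removes one element at a time.

    It is solved by a discrete Morse matching.  Let [a] be the least element of
    [S] and read [S] as long as it agrees with the pattern
      [a, a + 1, a + (t + 1), a + (t + 1) + 1, a + 2 (t + 1), ...]
    whose gaps are alternately [1] and [t].  When the agreement stops at
    [c = a + q (t + 1) + 1], the element [c] may be added to or removed from [S]
    without leaving the good sets, and this toggling is an involution.  It
    always keeps [(a, q)], while any other removal of an element leading to the
    lower half of a matched pair increases [(a, q)] lexicographically
    ([weight_incr]).  So the boundary is triangular on matched pairs, which bounds
    its ranks from below; when all unmatched sets have the same size, [d^2 = 0]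
    forces equality, and the homology has the dimension that counts the unmatched
    sets ([betti_matching]).

    A good set is unmatched only if the pattern reaches the end of [0, ..., k - 1].
    It then wraps around either with a gap [t], so that [k = q (t + 1)] and each
    [a < t] occurs, or with a gap [a + 1], so that [k = q (t + 1) + a + 1].  These
    are the cases [d = 0], with [t] unmatched sets of size [2 p], and [d <> 0], with
    one unmatched set of size [2 p + 1] ([critical_card], [card_critical]). *)

Set Implicit Arguments.
Unset Strict Implicit.
Unset Printing Implicit Defensive.

Import GRing.Theory.
Local Open Scope ring_scope.

(** * Restricting polynomials to a set of monomials; graded matrices *)

Section MonomialFilter.
Variables (K : fieldType) (n : nat).
Implicit Types (P Q : pred 'X_{1..n}) (q r : {mpoly K[n]}).

(** One operator serves two purposes: taking the homogeneous component of a
    polynomial, and, in the contraction of the Taylor complex, selecting the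
    monomials for which a given generator is the chosen divisor. *)
Definition mfilter P q : {mpoly K[n]} :=
  \sum_(u <- msupp q | P u) q@_u *: 'X_[u].

Lemma mcoeff_filter P q u : (mfilter P q)@_u = if P u then q@_u else 0.
Proof.
rewrite /mfilter raddf_sum /=.
have [uq|uq] := boolP (u \in msupp q); last first.
  rewrite (memN_msupp_eq0 uq) if_same big_seq_cond big1 // => v /andP[vq _].
  rewrite mcoeffZ mcoeffX; case: eqP => [vu|]; last by rewrite mulr0.
  by rewrite -vu vq in uq.
rewrite big_mkcond (bigD1_seq u) ?msupp_uniq //= big1 ?addr0 => [|v nvu].
  by rewrite mcoeffZ mcoeffX eqxx mulr1.
by case: ifP => // _; rewrite mcoeffZ mcoeffX (negPf nvu) mulr0.
Qed.

Lemma msupp_filter P q u : (u \in msupp (mfilter P q)) = P u && (u \in msupp q).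
Proof. by rewrite !mcoeff_msupp mcoeff_filter; case: (P u); rewrite ?eqxx. Qed.

Lemma mfilter_id P q : {in msupp q, forall u, P u} -> mfilter P q = q.
Proof.
move=> Pq; apply/mpolyP=> u; rewrite mcoeff_filter; case: ifP => // nPu.
by rewrite memN_msupp_eq0 //; apply/negP => /Pq; rewrite nPu.
Qed.

Lemma mfilter_is_linear P : linear (mfilter P).
Proof.
move=> c q r; apply/mpolyP=> u; rewrite mcoeffD mcoeffZ !mcoeff_filter.
by rewrite mcoeffD mcoeffZ; case: ifP => // _; rewrite mulr0 addr0.
Qed.

HB.instance Definition _ P :=
  GRing.isLinear.Build K {mpoly K[n]} {mpoly K[n]} _ (mfilter P)
    (mfilter_is_linear P).

(** If membership of [u + v] in [P] depends only on [u] for the monomials [v] of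
    [r], then multiplication by [r] commutes with the restriction.  With [r]
    homogeneous or a monomial this is the compatibility of gradings with products. *)
Lemma mfilterM P Q q r :
  (forall u v, v \in msupp r -> P (u + v)%MM = Q u) ->
  mfilter P (q * r) = mfilter Q q * r.
Proof.
move=> PQ; apply/mpolyP=> u; rewrite mcoeff_filter !mcoeffM.
case: ifP => Pu; [|apply/esym; apply: big1 => k /eqP uE; rewrite mcoeff_filter].
  apply: eq_bigr => k /eqP uE; rewrite mcoeff_filter.
  have [k2r|k2r] := boolP ((k.2 : 'X_{1..n}) \in msupp r).
    by rewrite -(PQ _ _ k2r) -uE Pu.
  by rewrite (memN_msupp_eq0 k2r) !mulr0.
have [k2r|k2r] := boolP ((k.2 : 'X_{1..n}) \in msupp r).
  by rewrite -(PQ _ _ k2r) -uE Pu mul0r.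
by rewrite (memN_msupp_eq0 k2r) mulr0.
Qed.

End MonomialFilter.

Section GradedMatrices.
Variables (K : fieldType) (n : nat).
Local Notation R := {mpoly K[n]}.

(** The matrix of a homogeneous map of degree zero between graded free modules.  The
    condition is on monomials, with a sum of degrees, because [sr a - sc b] may be
    negative, in which case the entry has to vanish. *)
Definition graded_mx r c (sr : 'I_r -> nat) (sc : 'I_c -> nat) (A : 'M[R]_(r, c)) :=
  forall a b u, u \in msupp (A a b) -> (mdeg u + sc b)%N = sr a.

(** Replaces a map by its component of degree zero.  It turns an arbitrary lift
    through a graded map into a graded one, by [homogenizeM]. *)
Definition homogenize r c (sr : 'I_r -> nat) (sc : 'I_c -> nat) (A : 'M[R]_(r, c)) :=
  \matrix_(a, b) mfilter (fun u => (mdeg u + sc b == sr a)%N) (A a b).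

Lemma homogenize_graded r c sr sc (A : 'M[R]_(r, c)) :
  graded_mx sr sc (homogenize sr sc A).
Proof. by move=> a b u; rewrite mxE msupp_filter => /andP[/eqP]. Qed.

Lemma homogenize_id r c sr sc (A : 'M[R]_(r, c)) :
  graded_mx sr sc A -> homogenize sr sc A = A.
Proof.
move=> Agr; apply/matrixP => a b; rewrite mxE mfilter_id // => u uA.
exact/eqP/Agr.
Qed.

Lemma homogenizeM r c e sr sc se (A : 'M[R]_(r, c)) (B : 'M[R]_(c, e)) :
  graded_mx sc se B -> homogenize sr se (A *m B) = homogenize sr sc A *m B.
Proof.
move=> Bgr; apply/matrixP => a b; rewrite !mxE raddf_sum /=.
apply: eq_bigr => k _; rewrite mxE.
by apply: mfilterM => u v /Bgr <-; rewrite mdegD addnA.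
Qed.

Lemma graded_mxM r c e sr sc se (A : 'M[R]_(r, c)) (B : 'M[R]_(c, e)) :
  graded_mx sr sc A -> graded_mx sc se B -> graded_mx sr se (A *m B).
Proof.
move=> Agr Bgr; rewrite -(homogenize_id Agr) -(homogenizeM _ _ Bgr).
exact: homogenize_graded.
Qed.

Lemma graded_mxB r c sr sc (A B : 'M[R]_(r, c)) :
  graded_mx sr sc A -> graded_mx sr sc B -> graded_mx sr sc (A - B).
Proof.
move=> Agr Bgr a b u; rewrite !mxE => /msuppD_le; rewrite mem_cat (perm_mem (msuppN _)).
by case/orP => [/Agr|/Bgr].
Qed.

Lemma graded_mx1 r (s : 'I_r -> nat) : graded_mx s s 1%:M.
Proof.
move=> a b u; rewrite mxE; case: eqP => [->|_]; rewrite ?msupp0 // msupp1.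
by rewrite inE => /eqP ->; rewrite mdeg0.
Qed.

(** The degree [j] part of the map obtained by tensoring with [K].  A homogeneous
    map sends a basis element of degree [j] to a combination, modulo the variables,
    of basis elements of degree [j] only, so no information is lost and the
    construction is multiplicative ([strandM]). *)
Definition strand r c (j : nat) (sr : 'I_r -> nat) (sc : 'I_c -> nat) (A : 'M[R]_(r, c)) :
    'M[K]_(#|[set a | sr a == j]|, #|[set b | sc b == j]|) :=
  \matrix_(a, b) (A (enum_val a) (enum_val b))@_0.

Lemma strandM r c e j sr sc se (A : 'M[R]_(r, c)) (B : 'M[R]_(c, e)) :
  graded_mx sr sc A -> strand j sr se (A *m B) = strand j sr sc A *m strand j sc se B.
Proof.
move=> Agr; apply/matrixP => a b; rewrite !mxE raddf_sum /=.
under [RHS]eq_bigr => k _ do rewrite !mxE -rmorphM /=.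
rewrite -(big_enum_val (fun k => (A (enum_val a) k * B k (enum_val b))@_0)).
rewrite [RHS]big_mkcond; apply: eq_bigr => k _; rewrite inE; case: ifP => // nk.
rewrite (rmorphM (mcoeff 0%MM)) /= memN_msupp_eq0 ?mul0r //.
apply/negP => /Agr; rewrite mdeg0 add0n => sk.
by have := enum_valP a; rewrite inE -sk nk.
Qed.

Lemma strandB r c j sr sc (A B : 'M[R]_(r, c)) :
  strand j sr sc (A - B) = strand j sr sc A - strand j sr sc B.
Proof. by apply/matrixP => a b; rewrite !mxE mcoeffB. Qed.

Lemma strandD r c j sr sc (A B : 'M[R]_(r, c)) :
  strand j sr sc (A + B) = strand j sr sc A + strand j sr sc B.
Proof. by apply/matrixP => a b; rewrite !mxE mcoeffD. Qed.

Lemma strand1 r j (s : 'I_r -> nat) : strand j s s 1%:M = 1%:M.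
Proof.
apply/matrixP => a b; rewrite !mxE (inj_eq enum_val_inj).
by case: eqP => _; rewrite ?mcoeff1 ?mcoeff0 ?eqxx.
Qed.

Lemma strand0 r c j sr sc : strand j sr sc (0 : 'M[R]_(r, c)) = 0.
Proof. by apply/matrixP => a b; rewrite !mxE mcoeff0. Qed.

End GradedMatrices.

(** * Comparison of graded free resolutions *)

Lemma dependent_choice (T : nat -> Type) (P : forall i, T i -> Prop)
    (E : forall i, T i -> T i.+1 -> Prop) (x0 : T 0%N) :
  P 0%N x0 ->
  (forall i x, P i x -> exists2 y, P i.+1 y & E i x y) ->
  exists f : forall i, T i,
    [/\ f 0%N = x0, forall i, P i (f i) & forall i, E i (f i) (f i.+1)].
Proof.
move=> P0 step.
have next i (x : {x : T i | P i x}) :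
    {y : {y : T i.+1 | P i.+1 y} | E i (sval x) (sval y)}.
  apply: constructive_indefinite_description.
  by have [y Py Exy] := step i _ (svalP x); exists (exist _ y Py).
pose f := fix f i : {x : T i | P i x} :=
  if i is i'.+1 then sval (next i' (f i')) else exist _ x0 P0.
exists (fun i => sval (f i)); split=> // i; first exact: (svalP (f i)).
exact: (svalP (next i (f i))).
Qed.

Section Resolutions.
Variables (K : fieldType) (n : nat).
Local Notation R := {mpoly K[n]}.
Implicit Types F G : graded_free_seq K n.
Local Notation sh F i := (@shift K n F i).

Record homogeneous_ideal (J : R -> Prop) : Prop := {
  ideal0 : J 0;
  idealD : forall q r, J q -> J r -> J (q + r);
  idealM : forall q r, J r -> J (q * r);
  ideal_homog : forall d q, J q -> J (mfilter (fun u => mdeg u == d) q)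
}.

(** Treats the augmentation to [R/J] as the differential leaving position [0], so
    that exactness has the same form in all positions. *)
Definition is_cycle (J : R -> Prop) F (i : nat) : 'rV[R]_(rank F i) -> Prop :=
  match i with
  | 0 => fun v => J ((v *m aug F) 0 0)
  | i'.+1 => fun v => v *m diff F i' = 0
  end.

Record graded_resolution (J : R -> Prop) F : Prop := {
  res_aug : graded_mx (sh F 0) (fun=> 0%N) (aug F);
  res_diff : forall i, graded_mx (sh F i.+1) (sh F i) (diff F i);
  res_onto : forall q, exists v : 'rV[R]_(rank F 0), J (q - (v *m aug F) 0 0);
  res_exact : forall i v, is_cycle J (F := F) (i := i) v <-> exists w, v = w *m diff F i
}.

Lemma minimal_graded_resolution J F :
  minimal_graded_free_resolution J F -> graded_resolution J F.
Proof.
case=> ga gd onto e0 eS _; split=> //.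
- move=> a b u; rewrite ord1 addn0; have /dhomogP := ga a; exact.
- by case=> [|i] v; [apply: e0|apply: eS].
Qed.

Section FixedIdeal.
Variable J : R -> Prop.
Hypothesis homJ : homogeneous_ideal J.

Lemma idealB q r : J q -> J r -> J (q - r).
Proof.
by move=> Jq Jr; apply: (idealD homJ) => //; rewrite -mulN1r; apply: (idealM homJ).
Qed.

Lemma ideal_mulmx r (v : 'rV[R]_r) (B : 'cV[R]_r) :
  (forall a, J (B a 0)) -> J ((v *m B) 0 0).
Proof.
move=> JB; rewrite mxE; apply: (big_ind J); first exact: (ideal0 homJ).
  exact: (idealD homJ).
by move=> a _; apply: (idealM homJ).
Qed.

(** Projectivity of a free module, in matrix form: the rows are lifted one by one,
    and the matrix of lifts is then made homogeneous. *)
Lemma lift_cycles G i r (s : 'I_r -> nat) (A : 'M[R]_(r, rank G i)) :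
  graded_resolution J G -> graded_mx s (sh G i) A ->
  (forall v, is_cycle J (v *m A)) ->
  exists2 W : 'M[R]_(r, rank G i.+1),
    graded_mx s (sh G i.+1) W & A = W *m diff G i.
Proof.
move=> resG Agr cycA.
have /fin_all_exists [w wE] a : exists w : 'rV_(rank G i.+1), row a A = w *m diff G i.
  by apply/(res_exact resG); rewrite rowE; apply: cycA.
exists (homogenize s (sh G i.+1) (\matrix_a w a)); first exact: homogenize_graded.
rewrite -(homogenizeM _ _ (res_diff resG (i:=i))) -[LHS](homogenize_id Agr).
by congr homogenize; apply/row_matrixP => a; rewrite row_mul rowK wE.
Qed.

(** The square formed with the two augmentations commutes modulo [J]: the map covers
    the identity of [R/J]. *)
Definition lifts_identity F G (A : 'M[R]_(rank F 0, rank G 0)) :=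
  forall a, J ((aug F - A *m aug G) a 0).

Lemma lift_aug F G : graded_resolution J F -> graded_resolution J G ->
  exists2 A : 'M[R]_(rank F 0, rank G 0),
    graded_mx (sh F 0) (sh G 0) A & lifts_identity A.
Proof.
move=> resF resG.
have /fin_all_exists [w wE] a := res_onto resG (aug F a 0).
exists (homogenize (sh F 0) (sh G 0) (\matrix_a w a)); first exact: homogenize_graded.
move=> a; rewrite -(homogenizeM _ _ (res_aug resG)).
rewrite -{1}(homogenize_id (res_aug resF)) !mxE -raddfB /=.
have -> q : mfilter (fun u => (mdeg u + 0 == shift a)%N) q =
    mfilter (fun u => mdeg u == shift a) q.
  by apply/mpolyP => u; rewrite !mcoeff_filter addn0.
apply: (ideal_homog homJ); have := wE a; congr (J (_ - _)).
by rewrite !mxE; apply: eq_bigr => b _; rewrite mxE.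
Qed.

(** The induction must remember that the last matrix built sends cycles to
    cycles: the boundaries of [F] are then sent to cycles of [G], which lift. *)
Lemma comparison_map F G : graded_resolution J F -> graded_resolution J G ->
  exists f : forall i, 'M[R]_(rank F i, rank G i),
    [/\ forall i, graded_mx (sh F i) (sh G i) (f i),
        forall i, diff F i *m f i = f i.+1 *m diff G i
      & lifts_identity (f 0%N)].
Proof.
move=> resF resG; have [A Agr Aid] := lift_aug resF resG.
pose P i (f : 'M[R]_(rank F i, rank G i)) :=
  graded_mx (sh F i) (sh G i) f /\ (forall v, is_cycle J v -> is_cycle J (v *m f)).
have P0 : P 0%N A.
  split=> // v /= Jv; rewrite -mulmxA.
  have := idealB Jv (ideal_mulmx v Aid).
  rewrite /= mulmxBr mulmxA; move: (v *m aug F) (_ *m aug G) => x y.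
  by rewrite [in X in X -> _]mxE [(- y) _ _]mxE opprB addrC subrK.
have := @dependent_choice (fun i => 'M[R]_(rank F i, rank G i)) P
  (fun i x y => diff F i *m x = y *m diff G i) A P0.
case=> [i x [xgr xcyc]|f [f0 Pf fE]]; last first.
  by exists f; split=> // [i|]; [case: (Pf i)|rewrite f0].
have [||y ygr yE] := @lift_cycles G i _ (sh F i.+1) (diff F i *m x) resG.
- exact: graded_mxM (res_diff resF (i := i)) xgr.
- by move=> v; rewrite mulmxA; apply: xcyc; apply/(res_exact resF); exists v.
exists y => //; split=> // v /= v0.
by rewrite -mulmxA -yE mulmxA v0 mul0mx.
Qed.

(** At each stage the error [phi i - h i *m diff G i] is killed by the incoming
    differential of [F]; this makes the next error a cycle of [G], hence a boundary. *)
Lemma null_homotopy F G (phi : forall i, 'M[R]_(rank F i, rank G i)) :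
  graded_resolution J F -> graded_resolution J G ->
  (forall i, graded_mx (sh F i) (sh G i) (phi i)) ->
  (forall i, diff F i *m phi i = phi i.+1 *m diff G i) ->
  (forall a, J ((phi 0%N *m aug G) a 0)) ->
  exists h : forall i, 'M[R]_(rank F i, rank G i.+1),
    [/\ forall i, graded_mx (sh F i) (sh G i.+1) (h i),
        phi 0%N = h 0%N *m diff G 0
      & forall i, phi i.+1 = h i.+1 *m diff G i.+1 + diff F i *m h i].
Proof.
move=> resF resG phigr phiE phi0.
have [|h0 h0gr h0E] := @lift_cycles G 0 _ _ (phi 0%N) resG (phigr 0%N).
  by move=> v /=; rewrite -mulmxA; apply: ideal_mulmx.
pose P i (h : 'M[R]_(rank F i, rank G i.+1)) :=
  graded_mx (sh F i) (sh G i.+1) h /\ diff F i *m (phi i - h *m diff G i) = 0.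
have P0 : P 0%N h0 by split=> //; rewrite -h0E subrr mulmx0.
have := @dependent_choice (fun i => 'M[R]_(rank F i, rank G i.+1)) P
  (fun i x y => phi i.+1 = y *m diff G i.+1 + diff F i *m x) h0 P0.
case=> [i x [xgr xE]|h [hh0 Ph hE]]; last first.
  by exists h; split=> // [i|]; [case: (Ph i)|rewrite hh0].
have [||y ygr yE] := @lift_cycles G i.+1 _ (sh F i.+1) (phi i.+1 - diff F i *m x) resG.
- apply: graded_mxB (phigr _) _; exact: graded_mxM (res_diff resF (i := i)) xgr.
- move=> v /=; rewrite -mulmxA mulmxBl -phiE -!mulmxA -mulmxBr xE mulmx0 //.
exists y; last by rewrite -yE subrK.
split=> //; rewrite -yE opprB addrC subrK mulmxA.
suff -> : diff F i.+1 *m diff F i = 0 by rewrite mul0mx.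
apply/row_matrixP => a; rewrite row_mul row0.
by apply/(res_exact resF (i := i.+1)); exists (delta_mx 0 a); rewrite rowE.
Qed.

Lemma lifts_identity_comp F G (A : 'M[R]_(rank F 0, rank G 0))
    (B : 'M[R]_(rank G 0, rank F 0)) :
  lifts_identity A -> lifts_identity B ->
  forall a, J (((1%:M - A *m B) *m aug F) a 0).
Proof.
move=> Aid Bid a.
rewrite mulmxBl mul1mx -mulmxA.
have -> : aug F - A *m (B *m aug F) =
    (aug F - A *m aug G) + A *m (aug G - B *m aug F).
  by rewrite mulmxBr addrA subrK.
rewrite mxE; apply: (idealD homJ) => //.
have := ideal_mulmx (row a A) Bid; rewrite -row_mul mxE //.
Qed.

End FixedIdeal.

(** Nothing leaves position [0]: the augmentation is not part of the complex obtained
    by tensoring with [K]. *)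
Definition outgoing_rank G (j i : nat) : nat :=
  if i is i'.+1 then \rank (strand j (sh G i'.+1) (sh G i') (diff G i')) else 0%N.

End Resolutions.

(** Here [f] and [g] are maps between a space of dimension [b], with zero
    differential, and a complex, inverse to each other up to homotopy.  The kernel
    of [D0] is then the direct sum of the image of [D1] and of the image of [f]. *)
Lemma homology_dim (K : fieldType) b N M N' (D0 : 'M[K]_(N, M)) (D1 : 'M[K]_(N', N))
    (f : 'M[K]_(b, N)) (g : 'M[K]_(N, b)) h h' :
  D1 *m D0 = 0 -> f *m D0 = 0 -> D1 *m g = 0 -> f *m g = 1%:M ->
  1%:M - g *m f = h *m D1 + D0 *m h' ->
  N = (\rank D0 + \rank D1 + b)%N.
Proof.
move=> D10 fD0 D1g fg hE.
have dis : (D1 :&: f)%MS = 0.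
  apply/eqP; rewrite -submx0; apply/rV_subP => v; rewrite sub_capmx.
  case/andP=> /submxP[x xE] /submxP[y yE].
  have : v *m g = 0 by rewrite xE -mulmxA D1g mulmx0.
  by rewrite {1}yE -mulmxA fg mulmx1 => y0; rewrite yE y0 mul0mx sub0mx.
have rf : \rank f = b.
  apply/eqP; apply/row_freeP; by exists g.
have ker : (kermx D0 :=: D1 + f)%MS.
  apply/eqmxP/andP; split; last first.
    by rewrite addsmx_sub; apply/andP; split; apply/sub_kermxP.
  apply/rV_subP => v /sub_kermxP vD0.
  have -> : v = (v *m h) *m D1 + (v *m g) *m f.
    rewrite -[LHS]mulmx1 -(subrK (g *m f) 1%:M) hE !mulmxDr !mulmxA vD0.
    by rewrite mul0mx addr0.
  exact: addmx_sub_adds (submxMl _ _) (submxMl _ _).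
have := mxrank_disjoint_sum dis; rewrite -ker mxrank_ker rf => E.
by rewrite -addnA -E subnKC // rank_leq_row.
Qed.

Local Notation sh F i := (@shift _ _ F i).

(** Both composites of the comparison maps are homotopic to the identity.  On the
    minimal side the homotopy dies modulo the variables, so one composite is the
    identity there, and [homology_dim] applies. *)
Lemma strand_dim (K : fieldType) n (J : {mpoly K[n]} -> Prop)
    (F G : graded_free_seq K n) :
  homogeneous_ideal J -> minimal_graded_free_resolution J F ->
  graded_resolution J G ->
  forall i j : nat,
  #|[set a | sh G i a == j]| =
    (outgoing_rank G j i + outgoing_rank G j i.+1 + graded_betti F i j)%N.
Proof.
move=> homJ minF resG i j.
have resF := minimal_graded_resolution minF.
have [f [fgr fE fid]] := comparison_map homJ resF resG.
have [g [ggr gE gid]] := comparison_map homJ resG resF.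
have nullF : forall i, strand j (sh F i.+1) (sh F i) (diff F i) = 0.
  by move=> i'; apply/matrixP => a b; rewrite !mxE (minimal minF).
have dFgr := res_diff resF; have dGgr := res_diff resG.
have [||| hF [hFgr hF0 hFS]] := @null_homotopy K n J homJ F F
   (fun i => 1%:M - f i *m g i) resF resF.
- move=> i'; apply: graded_mxB (@graded_mx1 _ _ _ _) (graded_mxM (fgr _) (ggr _)).
- move=> i'; rewrite mulmxBr mulmxBl mulmx1 mul1mx mulmxA fE -mulmxA gE mulmxA //.
- exact: lifts_identity_comp.
have [||| hG [hGgr hG0 hGS]] := @null_homotopy K n J homJ G G
   (fun i => 1%:M - g i *m f i) resG resG.
- move=> i'; apply: graded_mxB (@graded_mx1 _ _ _ _) (graded_mxM (ggr _) (fgr _)).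
- move=> i'; rewrite mulmxBr mulmxBl mulmx1 mul1mx mulmxA gE -mulmxA fE mulmxA //.
- exact: lifts_identity_comp.
have fg : strand j (sh F i) (sh G i) (f i) *m strand j (sh G i) (sh F i) (g i) = 1%:M.
  rewrite -(strandM _ _ _ (fgr i)) -(strand1 _ n j); apply/esym/eqP.
  rewrite -subr_eq0 -strandB; apply/eqP.
  case: i => [|i'].
    by rewrite hF0 (strandM _ _ _ (hFgr _)) nullF mulmx0.
  rewrite hFS strandD (strandM _ _ _ (hFgr _)) nullF mulmx0 add0r.
  by rewrite (strandM _ _ _ (dFgr _)) nullF mul0mx.
have D1g :
    strand j (sh G i.+1) (sh G i) (diff G i) *m strand j (sh G i) (sh F i) (g i) = 0.
  by rewrite -(strandM _ _ _ (dGgr _)) gE (strandM _ _ _ (ggr _)) nullF mulmx0.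
case: i => [|i] in fg D1g *.
  (* the map leaving position [0] is encoded as a matrix without columns *)
  have -> : outgoing_rank G j 0 = \rank (0 : 'M[K]_(#|[set a | sh G 0 a == j]|, 0)).
    by rewrite mxrank0.
  apply: (@homology_dim _ _ _ 0 _ 0 _ _ _
            (strand j (sh G 0) (sh G 1) (hG 0%N)) 0 _ _ D1g fg).
  - by rewrite mulmx0.
  - by rewrite mulmx0.
  rewrite mul0mx addr0 -(strandM _ _ _ (ggr _)) -(strand1 _ n j) -strandB hG0.
  by rewrite (strandM _ _ _ (hGgr _)).
apply: (@homology_dim _ _ _ _ _ _ _ _ _
          (strand j (sh G i.+1) (sh G i.+2) (hG i.+1))
          (strand j (sh G i) (sh G i.+1) (hG i)) _ _ D1g fg).
- rewrite -(strandM _ _ _ (dGgr _)) (_ : _ *m _ = 0) ?strand0 //.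
  apply/row_matrixP => a; rewrite row_mul row0.
  by apply/(res_exact resG (i := i.+1)); exists (delta_mx 0 a); rewrite rowE.
- by rewrite -(strandM _ _ _ (fgr _)) -fE (strandM _ _ _ (dFgr _)) nullF mul0mx.
rewrite -(strandM _ _ _ (ggr _)) -(strand1 _ n j) -strandB hGS strandD.
by rewrite (strandM _ _ _ (hGgr _)) (strandM _ _ _ (dGgr _)).
Qed.

(** * The boundary of a full simplex and its contractions *)

Section Simplex.
Variables (K : fieldType) (k : nat).
Implicit Types (S T : {set 'I_k}) (x y z : 'I_k) (c : {set 'I_k} -> K).

(** The sign attached to removing [x] from [S], or to adding it: it does not change
    when [x] itself is added or removed. *)
Definition sgn x S : K := (-1) ^+ #|[set y in S | (y < x)%N]|.

Lemma sgnU1 x y T : x \notin T -> sgn y (x |: T) = (-1) ^+ (x < y)%N * sgn y T.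
Proof.
move=> xT; rewrite /sgn -exprD; congr (_ ^+ _).
have [xy|yx] := boolP (x < y)%N.
  have := cardsU1 x [set z in T | (z < y)%N]; rewrite inE (negPf xT) /= => <-.
  by apply: eq_card => z; rewrite !inE; case: eqP => [->|].
apply: eq_card => z; rewrite !inE; case: eqP => [->|] //=.
by rewrite (negPf yx) andbF.
Qed.

Lemma sgnU1_id x T : sgn x (x |: T) = sgn x T.
Proof.
congr (_ ^+ _); apply: eq_card => z; rewrite !inE.
by case: eqP => [->|] //=; rewrite ltnn andbF.
Qed.

Lemma sgnD1_id x T : sgn x (T :\ x) = sgn x T.
Proof.
congr (_ ^+ _); apply: eq_card => z; rewrite !inE.
by case: eqP => [->|] //=; rewrite ltnn andbF.
Qed.

Lemma sgn_mul x S : sgn x S * sgn x S = 1.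
Proof. by rewrite /sgn -exprD addnn -mul2n exprM sqrrN expr1n expr1n. Qed.

Lemma signC_lt x y : x != y -> (-1) ^+ (x < y)%N = - (-1) ^+ (y < x)%N :> K.
Proof.
rewrite -val_eqE neq_ltn => /orP[] lt; rewrite lt ltnNge (ltnW lt) //.
by rewrite opprK.
Qed.

Lemma sgn_swap x y T : x != y -> x \notin T -> y \notin T ->
  sgn x T * sgn y (x |: T) = - (sgn y T * sgn x (y |: T)).
Proof.
move=> nxy xT yT; rewrite !sgnU1 // mulrCA [sgn y T * _]mulrCA (signC_lt nxy).
by rewrite mulNr [sgn y T * _]mulrC.
Qed.

Definition bd c T : K := \sum_(x | x \notin T) sgn x T * c (x |: T).

(** Adding [x] and then [y], or [y] and then [x], gives the same set with opposite
    signs; the double sum is split according to [x < y] or [y < x]. *)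
Lemma bd_bd c T : bd (bd c) T = 0.
Proof.
pose G x y := sgn x T * sgn y (x |: T) * c (y |: (x |: T)).
pose P x y := [&& x \notin T, y \notin T & x != y].
have -> : bd (bd c) T = \sum_x \sum_(y | P x y) G x y.
  rewrite /bd big_mkcond; apply: eq_bigr => x _.
  have [xT|xT] /= := boolP (x \in T).
    by rewrite big1 // => y; rewrite /P xT.
  rewrite big_distrr /=; apply: eq_big => [y|y _]; last by rewrite mulrA.
  by rewrite /P xT !inE negb_or eq_sym andbC.
have split1 x : \sum_(y | P x y) G x y =
   \sum_(y | P x y && (x < y)%N) G x y + \sum_(y | P x y && (y < x)%N) G x y.
  rewrite (bigID (fun y => (x < y)%N)) /=; congr (_ + _).
  apply: eq_bigl => y; case Pxy: (P x y) => //=.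
  have /and3P[_ _ nxy] := Pxy.
  by rewrite -leqNgt leq_eqVlt; rewrite -val_eqE eq_sym in nxy; rewrite (negPf nxy).
rewrite (eq_bigr _ (fun x _ => split1 x)) big_split /=.
rewrite [X in _ + X](exchange_big_dep predT) //=.
rewrite -big_split big1 //= => x _.
rewrite [X in _ + X](eq_bigl (fun y => P x y && (x < y)%N)); last first.
  by move=> y; rewrite /P [y == x]eq_sym andbCA.
rewrite -big_split big1 //= => y /andP[/and3P[xT yT nxy] _].
by rewrite /G sgn_swap // setUCA mulNr addNr.
Qed.

(** Coefficients of the cone over a chain with apex [z].  On the full simplex it is a
    contracting homotopy ([bd_cone]). *)
Definition cone z c S : K := if z \in S then sgn z S * c (S :\ z) else 0.

Lemma bd_cone z c T : bd (cone z c) T + cone z (bd c) T = c T.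
Proof.
rewrite /bd /cone; have [zT|zT] := boolP (z \in T); last first.
  rewrite addr0 (bigD1 z) //= setU11 setU1K // big1 => [|x /andP[xT nxz]].
    by rewrite addr0 sgnU1_id mulrA sgn_mul mul1r.
  by rewrite !inE eq_sym (negPf nxz) (negPf zT) mulr0.
rewrite [X in _ + _ * X](bigD1 z) ?inE ?eqxx //= mulrDr mulrA sgnD1_id sgn_mul mul1r.
rewrite setD1K // addrCA -[RHS]addr0; congr (_ + _).
rewrite big_distrr /=.
rewrite [X in _ + X](eq_bigl (fun x => x \notin T)); last first.
  move=> x; rewrite !inE negb_and negbK; case: (altP (x =P z)) => [->|] /=.
    by rewrite zT.
  by rewrite andbT.
rewrite -big_split big1 //= => x xT.
have nxz : x != z by apply: contraNneq xT => ->.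
rewrite !inE zT orbT.
have xTz : x \notin T :\ z by rewrite inE (negPf xT) andbF.
have zTz : z \notin T :\ z by rewrite !inE eqxx.
have xTE : (x |: T) :\ z = x |: T :\ z.
  apply/setP => y; rewrite !inE; case: (altP (y =P z)) => [->|] //=.
  by rewrite eq_sym (negPf nxz).
rewrite xTE -(sgnD1_id z T) -(sgnD1_id z (x |: T)) xTE -{1}(setD1K zT) !sgnU1 //.
rewrite -[X in _ * X + _]mulrA mulrACA [sgn x _ * (_ * _)]mulrCA (signC_lt nxz).
by rewrite mulrN -expr2 sqrr_sign mulN1r addNr.
Qed.

End Simplex.

(** * The Taylor complex of a family of monomials *)

Lemma mpoly_divX (K : fieldType) n (m : 'X_{1..n}) (q : {mpoly K[n]}) :
  (forall u, u \in msupp q -> (m <= u)%MM) -> exists r, q = r * 'X_[m].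
Proof.
move=> mq; exists (\sum_(u <- msupp q) q@_u *: 'X_[u - m]).
rewrite mulr_suml {1}[q]mpolyE big_seq [RHS]big_seq; apply: eq_bigr => u uq.
by rewrite -scalerAl -mpolyXD submK // mq.
Qed.

Section Taylor.
Variables (K : fieldType) (n k : nat) (e : 'I_k -> 'X_{1..n}).
Local Notation R := {mpoly K[n]}.
Implicit Types (S T : {set 'I_k}) (x y z : 'I_k).

Definition monomial_ideal : R -> Prop := ideal_span (fun x => 'X_[e x] : R).

Definition mlcm_set S : 'X_{1..n} := [multinom \max_(x in S) e x i | i < n].

Lemma mlcm_setP S u : reflect (forall x, x \in S -> (e x <= u)%MM) (mlcm_set S <= u)%MM.
Proof.
apply: (iffP idP) => [/mnm_lepP Su x xS|Su]; apply/mnm_lepP => i.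
  by apply: leq_trans (Su i); rewrite mnmE (bigD1 x) //= leq_maxl.
by rewrite mnmE; apply/bigmax_leqP => x /Su /mnm_lepP.
Qed.

Lemma mlcm_set0 : mlcm_set set0 = 0%MM.
Proof. by apply/mnmP => i; rewrite mnmE mnm0E big_pred0 // => x; rewrite inE. Qed.

Lemma mlcm_set1 x : mlcm_set [set x] = e x.
Proof. by apply/mnmP => i; rewrite mnmE big_set1. Qed.

Lemma mlcm_setS S T : T \subset S -> (mlcm_set T <= mlcm_set S)%MM.
Proof.
move=> /subsetP TS; apply/mlcm_setP => x /TS xS.
by move/mlcm_setP: (lepm_refl (mlcm_set S)); apply.
Qed.

Definition faces (i : nat) : {set {set 'I_k}} := [set S : {set 'I_k} | #|S| == i].

Definition face i (a : 'I_#|faces i|) : {set 'I_k} := enum_val a.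

Lemma face_inj i : injective (@face i).
Proof. exact: enum_val_inj. Qed.

Lemma card_face i (a : 'I_#|faces i|) : #|face a| = i.
Proof. by have := enum_valP a; rewrite inE => /eqP. Qed.

Lemma faces_enum i S : #|S| = i -> exists a : 'I_#|faces i|, face a = S.
Proof.
move=> Si; have SA : S \in faces i by rewrite inE Si.
by exists (enum_rank_in SA S); rewrite /face enum_rankK_in.
Qed.

(** The empty set, of lcm [1], spans position [0], so that the differential leaving
    position [1] lists the generators of the ideal. *)
Definition taylor : graded_free_seq K n :=
  @GradedFreeSeq K n (fun i => #|faces i|)
    (fun i (a : 'I_#|faces i|) => mdeg (mlcm_set (face a)))
    (fun i => \matrix_(a < #|faces i.+1|, b < #|faces i|)
       \sum_(x in face a | face a :\ x == face b)
          sgn K x (face a) *: 'X_[mlcm_set (face a) - mlcm_set (face b)])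
    (const_mx 1).

(** Multiplying the coefficient of [S] by the monomial [lcm S] turns the Taylor
    differential into the simplicial boundary, monomial by monomial
    ([mcoeff_chain_diff]).  Vectors of the Taylor complex become the families of
    polynomials, indexed by sets of size [i], whose value at [S] is divisible by
    [lcm S] ([chain_divides], [chain_onto]). *)
Definition chain i (v : 'rV[R]_(rank taylor i)) S : R :=
  \sum_(a | face a == S) v 0 a * 'X_[mlcm_set S].

Lemma chain_face i (v : 'rV[R]_(rank taylor i)) a :
  chain v (face a) = v 0 a * 'X_[mlcm_set (face a)].
Proof.
rewrite /chain (eq_bigl (pred1 a)) ?big_pred1_eq // => b.
by rewrite (inj_eq (@face_inj i)).
Qed.

Lemma chain_supp i (v : 'rV[R]_(rank taylor i)) S : #|S| != i -> chain v S = 0.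
Proof.
move=> Si; rewrite /chain big_pred0 // => a; apply/negbTE; apply: contraNneq Si => <-.
by rewrite card_face.
Qed.

Lemma chain_inj i (v w : 'rV[R]_(rank taylor i)) : chain v =1 chain w -> v = w.
Proof.
move=> vw; apply/rowP => a; have := vw (face a); rewrite !chain_face.
by apply: mulIf; rewrite -msupp_eq0 msuppX.
Qed.

Lemma chain_divides i (v : 'rV[R]_(rank taylor i)) S u :
  u \in msupp (chain v S) -> (mlcm_set S <= u)%MM.
Proof.
have [Si|/chain_supp ->] := eqVneq #|S| i; last by rewrite msupp0.
have [a <-] := faces_enum Si; rewrite chain_face.
rewrite mcoeff_msupp mcoeffM => /eqP nz.
apply/negPn/negP => nle; apply: nz; rewrite big1 // => m /eqP uE.
rewrite mcoeffX; case: eqP => [mE|]; last by rewrite mulr0.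
by case/negP: nle; rewrite uE -mE lem_addl.
Qed.

Lemma chain_onto i (c : {set 'I_k} -> R) :
  (forall S, #|S| != i -> c S = 0) ->
  (forall S u, u \in msupp (c S) -> (mlcm_set S <= u)%MM) ->
  exists v : 'rV[R]_(rank taylor i), chain v =1 c.
Proof.
move=> c0 cdiv.
have /fin_all_exists [w wE] (a : 'I_#|faces i|) :
    exists r, c (face a) = r * 'X_[mlcm_set (face a)].
  by apply: mpoly_divX => u; apply: cdiv.
exists (\row_a w a) => S; have [Si|Si] := eqVneq #|S| i; last first.
  by rewrite chain_supp // c0.
by have [a <-] := faces_enum Si; rewrite chain_face mxE wE.
Qed.

Lemma chain_diff i (v : 'rV[R]_(rank taylor i.+1)) T :
  chain (v *m diff taylor i) T = \sum_(x | x \notin T) sgn K x T *: chain v (x |: T).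
Proof.
have [Ti|Ti] := eqVneq #|T| i; last first.
  rewrite chain_supp // big1 // => x xT; rewrite chain_supp ?scaler0 //.
  by rewrite cardsU1 xT add1n eqSS.
have [b bT] := faces_enum Ti; rewrite -{1}bT chain_face bT !mxE mulr_suml.
under eq_bigr => a _.
  rewrite mxE mulr_sumr mulr_suml bT.
  over.
rewrite (exchange_big_dep (fun x => x \notin T)) /=; last first.
  by move=> a x _ /andP[_ /eqP <-]; rewrite !inE eqxx.
apply: eq_bigr => x xT; rewrite /chain scaler_sumr; apply: eq_big => [a|a].
  apply/andP/eqP => [[xa /eqP <-]|->]; first by rewrite setD1K.
  by rewrite setU11 setU1K.
move=> /andP[xa /eqP aT].
have aE : face a = x |: T by rewrite -aT setD1K.
rewrite -scalerAr -scalerAl -mulrA -mpolyXD aE sgnU1_id submK //.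
by apply: mlcm_setS; rewrite subsetU1.
Qed.

Lemma mcoeff_chain_diff i (v : 'rV[R]_(rank taylor i.+1)) T u :
  (chain (v *m diff taylor i) T)@_u = bd (fun S => (chain v S)@_u) T.
Proof.
by rewrite chain_diff raddf_sum; apply: eq_bigr => x _; rewrite /= mcoeffZ.
Qed.

(** The apex used at the monomial [u].  The coefficients at [u] form a chain on the
    simplex of all the generators dividing [u], so that any of them would do; the
    choice must depend on [u] only. *)
Definition divisor u : option 'I_k := [pick x | (e x <= u)%MM].

(** At each monomial [u] the cone with apex [divisor u] bounds the given cycle.  The
    divisibility constraint survives because the apex divides [u]. *)
Lemma fill_cycle i (v : 'rV[R]_(rank taylor i)) :
  (forall T u, bd (fun S => (chain v S)@_u) T = 0) ->
  (forall S u, u \in msupp (chain v S) -> divisor u) ->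
  exists w, v = w *m diff taylor i.
Proof.
move=> vcyc vdiv.
pose c S := \sum_(x in S)
  sgn K x S *: mfilter (fun u => divisor u == Some x) (chain v (S :\ x)).
have cE S u :
    (c S)@_u = if divisor u is Some z then cone z (fun S => (chain v S)@_u) S else 0.
  rewrite /c raddf_sum /=.
  under eq_bigr => x _ do rewrite mcoeffZ mcoeff_filter.
  case: (divisor u) => [z|]; last by rewrite big1 // => x _; rewrite mulr0.
  rewrite /cone; case: ifP => zS.
    rewrite (bigD1 z) //= eqxx big1 ?addr0 // => x /andP[_ nxz].
    by case: eqP => [[zx]|]; rewrite ?mulr0 // zx eqxx in nxz *.
  by rewrite big1 // => x xS; case: eqP => [[zx]|]; rewrite ?mulr0 // -zx zS in xS *.
have [||w wE] := @chain_onto i.+1 c.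
- move=> S Si; rewrite /c big1 // => x xS; rewrite chain_supp ?raddf0 ?scaler0 //.
  by move: Si; rewrite (cardsD1 x S) xS add1n eqSS.
- move=> S u; rewrite mcoeff_msupp cE /divisor.
  case: pickP => [z zu|]; last by rewrite eqxx.
  rewrite /cone; case: ifP => [zS|]; last by rewrite eqxx.
  rewrite mulf_eq0 negb_or -mcoeff_msupp => /andP[_ /chain_divides /mlcm_setP Su].
  apply/mlcm_setP => x xS; have [->//|nxz] := eqVneq x z.
  by apply: Su; rewrite !inE nxz.
exists w; apply: chain_inj => T; apply/mpolyP => u; rewrite mcoeff_chain_diff.
have -> : bd (fun S => (chain w S)@_u) T = bd (fun S => (c S)@_u) T.
  by apply: eq_bigr => x _; rewrite wE.
case du: (divisor u) => [z|].
  rewrite -(bd_cone z (fun S => (chain v S)@_u)) [X in _ + X]/cone vcyc.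
  rewrite mulr0 if_same addr0.
  by apply: eq_bigr => x _; rewrite cE du.
rewrite memN_msupp_eq0; last by apply/negP => /vdiv; rewrite du.
by rewrite /bd big1 // => x _; rewrite cE du mulr0.
Qed.

Lemma divisor_ideal q u : monomial_ideal q -> u \in msupp q -> divisor u.
Proof.
case=> c ->; rewrite mcoeff_msupp /divisor; case: pickP => // nodiv.
rewrite raddf_sum big1 ?eqxx //= => x _.
rewrite mcoeffM big1 // => m /eqP uE; rewrite mcoeffX.
case: eqP => [mE|]; last by rewrite mulr0.
suff : (e x <= u)%MM by rewrite nodiv.
by rewrite [u]uE mE lem_addl.
Qed.

Lemma homogeneous_monomial_ideal : homogeneous_ideal monomial_ideal.
Proof.
split.
- by exists (fun=> 0); rewrite big1 // => x _; rewrite mul0r.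
- move=> q r [c ->] [c' ->]; exists (fun x => c x + c' x).
  by rewrite -big_split; apply: eq_bigr => x _; rewrite mulrDl.
- move=> q r [c ->]; exists (fun x => q * c x).
  by rewrite mulr_sumr; apply: eq_bigr => x _; rewrite mulrA.
- move=> d q [c ->].
  exists (fun x => mfilter (fun u => mdeg u + mdeg (e x) == d)%N (c x)).
  rewrite raddf_sum; apply: eq_bigr => x _; apply: mfilterM => u v.
  by rewrite msuppX inE => /eqP ->; rewrite mdegD.
Qed.

Lemma taylor_aug (v : 'rV[R]_(rank taylor 0)) : (v *m aug taylor) 0 0 = chain v set0.
Proof.
rewrite mxE /chain; apply: eq_big => [a|a _].
  by apply/esym; rewrite -cards_eq0 card_face.
by rewrite mxE mlcm_set0 mpolyX0.
Qed.

(** Exactness is [fill_cycle]: a nonempty set in the support of a chain at [u]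
    consists of divisors of [u], and in position [0] a polynomial lies in the ideal
    exactly when each of its monomials has a divisor among the generators. *)
Lemma taylor_resolution : graded_resolution monomial_ideal taylor.
Proof.
split.
- move=> a b u; rewrite mxE msupp1 inE => /eqP ->; rewrite mdeg0 /=.
  have /eqP -> : face a == set0 by rewrite -cards_eq0 card_face.
  by rewrite mlcm_set0 mdeg0.
- move=> i a b u; rewrite mxE mcoeff_msupp.
  have [TS|TS] := boolP (face b \subset face a); last first.
    rewrite big1 ?mcoeff0 ?eqxx // => x /andP[_ /eqP E].
    by rewrite -E subsetDl in TS.
  rewrite -scaler_suml mcoeffZ mcoeffX mulf_eq0 negb_or.
  case: ((_ - _)%MM =P u) => [<- _|_]; last by rewrite eqxx andbF.
  by rewrite -mdegD submK // mlcm_setS.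
- move=> q; have [a aE] := faces_enum (cards0 'I_k).
  exists (\row_b if b == a then q else 0); rewrite taylor_aug.
  rewrite -aE chain_face mxE eqxx aE mlcm_set0 mpolyX0 mulr1 subrr.
  exact: ideal0 homogeneous_monomial_ideal.
case=> [|i] v /=.
  rewrite taylor_aug; split=> [vJ|[w ->]].
    apply: fill_cycle => [T u|S u].
      rewrite /bd big1 // => x xT; rewrite chain_supp ?mcoeff0 ?mulr0 //.
      by rewrite cardsU1 xT.
    have [/cards0_eq ->|/chain_supp ->] := eqVneq #|S| 0%N; last by rewrite msupp0.
    exact: divisor_ideal.
  rewrite chain_diff; apply: (big_ind monomial_ideal).
  - exact: ideal0 homogeneous_monomial_ideal.
  - exact: idealD homogeneous_monomial_ideal.
  move=> x _; rewrite -mul_mpolyC; apply: (idealM homogeneous_monomial_ideal).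
  have [a aE] := faces_enum (cards1 x).
  rewrite setU0 -aE chain_face aE mlcm_set1.
  exists (fun y => if y == x then w 0 a else 0).
  rewrite (bigD1 x) //= eqxx big1 ?addr0 // => y /negPf ->; exact: mul0r.
split=> [vd|[w ->]].
  apply: fill_cycle => [T u|S u uS].
    rewrite -mcoeff_chain_diff vd /chain big1 ?mcoeff0 // => a _.
    by rewrite mxE mul0r.
  have [Si|Si] := eqVneq #|S| i.+1; last by rewrite chain_supp ?msupp0 in uS.
  have /card_gt0P[x xS] : (0 < #|S|)%N by rewrite Si.
  have /mlcm_setP/(_ x xS) xu := chain_divides uS.
  by rewrite /divisor; case: pickP => // /(_ x); rewrite xu.
apply: chain_inj => T; apply/mpolyP => u; rewrite mcoeff_chain_diff.
have -> : bd (fun S => (chain (w *m diff taylor i.+1) S)@_u) T =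
          bd (bd (fun S => (chain w S)@_u)) T.
  by apply: eq_bigr => x _; rewrite mcoeff_chain_diff.
rewrite bd_bd /chain big1 ?mcoeff0 // => a _; by rewrite mxE mul0r.
Qed.

End Taylor.

(** * Betti numbers from a matching on the Taylor complex *)

(** The rows in [U] are independent: in a linear relation, a row of least [phi]
    among those with nonzero coefficient is alone in meeting its column [b]. *)
Lemma rank_triangular (K : fieldType) r c (M : 'M[K]_(r, c)) (U : {set 'I_r})
    (phi : 'I_r -> nat) :
  (forall u, u \in U -> exists2 b, M u b != 0 &
     forall v, v \in U -> v != u -> M v b != 0 -> (phi v < phi u)%N) ->
  (#|U| <= \rank M)%N.
Proof.
move=> tri; pose f (i : 'I_#|U|) : 'I_r := enum_val i.
have fU i : f i \in U by apply: enum_valP.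
suff /eqP <- : row_free (rowsub f M) by apply/mxrankS/rowsub_sub.
apply: inj_row_free => w w0; apply/rowP => i; rewrite mxE.
have [m] := ubnP (phi (f i)); elim: m i => // m IH i; rewrite ltnS => im.
have [b Mb tri_b] := tri _ (fU i).
have := congr1 (fun A : 'rV_c => A 0 b) w0; rewrite !mxE (bigD1 i) //= big1 => [|j nij].
  by rewrite addr0 mxE => /eqP; rewrite mulf_eq0 (negPf Mb) orbF => /eqP.
rewrite mxE; have [->|Mj] := eqVneq (M (f j) b) 0; first by rewrite mulr0.
rewrite IH ?mul0r //; apply: leq_trans im; apply: tri_b => //.
by rewrite (inj_eq enum_val_inj).
Qed.

Section TaylorStrand.
Variables (K : fieldType) (n k : nat) (e : 'I_k -> 'X_{1..n}) (j : nat).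
Local Notation tay := (taylor K e).
Local Notation lcm := (mlcm_set e).

Definition strand_basis i : {set {set 'I_k}} :=
  [set S : {set 'I_k} | (#|S| == i) && (mdeg (lcm S) == j)].

Definition strand_face i (a : 'I_#|[set a | @shift K n tay i a == j]|) : {set 'I_k} :=
  face (enum_val a : 'I_#|faces k i|).

Lemma strand_face_inj i : injective (@strand_face i).
Proof. by move=> a b /face_inj /enum_val_inj. Qed.

Lemma strand_faceP i a : @strand_face i a \in strand_basis i.
Proof. by rewrite inE card_face eqxx; have := enum_valP a; rewrite inE. Qed.

Lemma strand_face_onto i S : S \in strand_basis i -> exists a, @strand_face i a = S.
Proof.
rewrite inE => /andP[/eqP Si Sj]; have [b bS] := faces_enum Si.
have bA : b \in [set a | @shift K n tay i a == j] by rewrite inE /= bS.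
by exists (enum_rank_in bA b); rewrite /strand_face enum_rankK_in.
Qed.

Lemma card_strand_preim i (A : {set {set 'I_k}}) : A \subset strand_basis i ->
  #|[set a | @strand_face i a \in A]| = #|A|.
Proof.
move=> sA; rewrite -(card_imset _ (@strand_face_inj i)); apply: eq_card => S.
apply/imsetP/idP => [[a]|SA]; first by rewrite inE => aA ->.
have [a aS] := strand_face_onto (subsetP sA _ SA).
by exists a; rewrite // inE aS.
Qed.

Lemma card_strand_basis i : #|[set a | @shift K n tay i a == j]| = #|strand_basis i|.
Proof.
rewrite -(card_strand_preim (subxx _)) -[LHS]card_ord; apply: eq_card => a.
by rewrite inE strand_faceP.
Qed.

(** If [S :\ x] has an lcm of the same degree as [S], the two lcms are equal, so
    the Taylor coefficient is a sign. *)
Lemma strand_diff i a b :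
  strand j (@shift K n tay i.+1) (@shift K n tay i) (diff tay i) a b =
  \sum_(x in strand_face a | strand_face a :\ x == strand_face b) sgn K x (strand_face a).
Proof.
rewrite mxE /= mxE raddf_sum /=; apply: eq_bigr => x /andP[xa /eqP E].
rewrite mcoeffZ mcoeffX.
suff -> : (lcm (strand_face a) - lcm (strand_face b))%MM = 0%MM by rewrite eqxx mulr1.
apply/eqP; rewrite -mdeg_eq0.
have ba : (lcm (strand_face b) <= lcm (strand_face a))%MM.
  by apply: mlcm_setS; rewrite -[strand_face b]E subsetDl.
have := congr1 (@mdeg n) (submK ba); rewrite mdegD.
have := strand_faceP a; have := strand_faceP b; rewrite !inE.
by move=> /andP[_ /eqP ->] /andP[_ /eqP ->] /(canRL (addnK _)) ->; rewrite subnn.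
Qed.

Variables (U D : {set {set 'I_k}}) (piv : {set 'I_k} -> 'I_k) (phi : {set 'I_k} -> nat).
Hypothesis U_deg : forall S, S \in U -> mdeg (lcm S) = j.
Hypothesis D_deg : forall S, S \in D -> mdeg (lcm S) = j.
Hypothesis U_piv : forall S, S \in U ->
  [/\ piv S \in S, S :\ piv S \in D & piv (S :\ piv S) = piv S].
Hypothesis D_piv : forall S, S \in D ->
  [/\ piv S \notin S, piv S |: S \in U & piv (piv S |: S) = piv S].
Hypothesis phi_incr : forall S T x, S \in U -> T \in U -> x \in S ->
  S :\ x = T :\ piv T -> S = T \/ (phi S < phi T)%N.

Definition critical i : {set {set 'I_k}} := strand_basis i :\: (U :|: D).

Let Ui i := [set S in U | #|S| == i].
Let Di i := [set S in D | #|S| == i].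

(** Restricted to the rows in [U] and to the columns of their partners the
    boundary is triangular for [phi], with signs on the diagonal. *)
Lemma matching_rank i : (#|Ui i| <= outgoing_rank tay j i)%N.
Proof.
case: i => [|i].
  rewrite leqn0 cards_eq0; apply/eqP/setP => S; rewrite !inE cards_eq0.
  by apply/negP => /andP[/U_piv[pS _ _] /eqP S0]; rewrite S0 inE in pS.
have sub : Ui i.+1 \subset strand_basis i.+1.
  by apply/subsetP => S; rewrite !inE => /andP[/U_deg -> ->]; rewrite eqxx.
rewrite -(card_strand_preim sub) /=.
apply: (rank_triangular (phi := fun a => phi (strand_face a))) => a.
rewrite inE [_ \in Ui _]inE => /andP[aU _]; have [pa aD _] := U_piv aU.
have [b bE] : exists b, @strand_face i b = strand_face a :\ piv (strand_face a).
  apply: strand_face_onto; rewrite inE D_deg // eqxx andbT.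
  have := strand_faceP a.
  by rewrite inE (cardsD1 (piv (strand_face a))) pa eqSS => /andP[].
exists b.
  rewrite strand_diff (big_pred1 (piv (strand_face a))) => [|x]; last first.
    rewrite bE /=; apply/andP/eqP => [[xa /eqP E]|->]; last by rewrite pa.
    apply/eqP/negPn/negP => nx; have := setD11 x (strand_face a).
    by rewrite E !inE nx xa.
  by rewrite /sgn signr_eq0.
move=> c; rewrite inE [_ \in Ui _]inE => /andP[cU _] nca; rewrite strand_diff bE => nz.
have /existsP[x /andP[xc /eqP E]] : [exists x, (x \in strand_face c) &&
    (strand_face c :\ x == strand_face a :\ piv (strand_face a))].
  apply: contraNT nz; rewrite negb_exists => /forallP none.
  by rewrite big_pred0 // => x; apply/negbTE/none.
have [/strand_face_inj ca|//] := phi_incr cU aU xc E.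
by rewrite ca eqxx in nca.
Qed.

Lemma matching_card i : #|Di i| = #|Ui i.+1|.
Proof.
have inj : {in Di i &, injective (fun S => piv S |: S)}.
  move=> S T; rewrite !inE => /andP[/D_piv[pS _ eS] _] /andP[/D_piv[pT _ eT] _] /= E.
  have pST : piv S = piv T by rewrite -eS -eT E.
  by rewrite -(setU1K pS) -(setU1K pT) E pST.
rewrite -(card_in_imset inj); apply: eq_card => S; apply/imsetP/idP => [[T]|].
  rewrite inE => /andP[/D_piv[pT TU _] /eqP Ti] ->.
  by rewrite inE TU cardsU1 pT Ti add1n eqxx.
rewrite inE => /andP[/U_piv[pS SD eS] Si]; exists (S :\ piv S); last by rewrite eS setD1K.
by rewrite inE SD /=; move: Si; rewrite (cardsD1 (piv S)) pS.
Qed.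

Lemma card_strand_matching i :
  #|strand_basis i| = (#|Ui i| + #|Di i| + #|critical i|)%N.
Proof.
have UD : [disjoint Ui i & Di i].
  rewrite -setI_eq0; apply/eqP/setP => S; rewrite !inE; apply/negP.
  by case/andP=> /andP[/U_piv[pS _ _] _] /andP[/D_piv[pS' _ _] _]; rewrite pS in pS'.
rewrite -(cardsID (U :|: D)); congr (_ + _)%N.
have := (leq_card_setU (Ui i) (Di i)).2; rewrite UD => /eqP <-.
apply: eq_card => S; rewrite !inE.
case SU: (S \in U); first by rewrite (U_deg SU) eqxx; case: (S \in D); case: (#|S| == i).
case SD: (S \in D); first by rewrite (D_deg SD) eqxx; case: (#|S| == i).
by rewrite !andbF.
Qed.

(** Write [r i] for the rank leaving position [i], so that the number of basis
    elements is [r i + r i.+1 + beta_i], and also [#|Ui i| + #|Ui i.+1| + #|critical i|].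
    As [#|Ui i| <= r i], all these bounds are equalities wherever [critical i] is
    empty.  Every position other than [i0] is of that kind; its two neighbours
    settle the ranks at [i0] as well. *)
Lemma betti_matching (J : {mpoly K[n]} -> Prop) (F : graded_free_seq K n) i0 :
  homogeneous_ideal J -> graded_resolution J tay ->
  minimal_graded_free_resolution J F ->
  (forall S, mdeg (lcm S) = j -> S \notin U :|: D -> #|S| = i0) ->
  forall i, graded_betti F i j = (if i == i0 then #|critical i0| else 0)%N.
Proof.
move=> homJ resT minF crit_i0.
have crit0 i : i != i0 -> #|critical i| = 0%N.
  move=> ni; apply/eqP; rewrite cards_eq0; apply/eqP/setP => S.
  rewrite in_setD in_set0 [S \in strand_basis i]inE.
  apply/negP => /and3P[nS /eqP Si /eqP Sj].
  by rewrite -Si (crit_i0 S) ?eqxx in ni.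
have dimE i : (#|Ui i| + #|Ui i.+1| + #|critical i| =
    outgoing_rank tay j i + outgoing_rank tay j i.+1 + graded_betti F i j)%N.
  rewrite -(strand_dim homJ minF resT) card_strand_basis card_strand_matching.
  by rewrite matching_card.
have tight i : i != i0 -> graded_betti F i j = 0%N /\
    outgoing_rank tay j i = #|Ui i| /\ outgoing_rank tay j i.+1 = #|Ui i.+1|.
  move=> ni; have := dimE i; rewrite crit0 //.
  have := matching_rank i; have := matching_rank i.+1; lia.
move=> i; case: eqP => [->|/eqP /tight[]//].
(* position [i0.+1] settles the rank entering [i0], position [i0.-1] the one leaving *)
have := dimE i0; have [_ [-> _]] := tight i0.+1 (negbT (gtn_eqF (ltnSn _))).
case: (posnP i0) => [->|i0_gt0].
  suff -> : #|Ui 0| = 0%N by rewrite /= ; lia.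
  by apply/eqP; rewrite -leqn0; apply: matching_rank.
have ni : i0.-1 != i0 by lia.
have [_ [_]] := tight _ ni; rewrite prednK // => ->; lia.
Qed.

End TaylorStrand.

(** * Subsets of a cycle meeting every interval of length [t] *)

Local Close Scope ring_scope.

Section CyclicMatching.
Variables (k t : nat) (k_gt0 : 0 < k).
Hypotheses (t_ge2 : 2 <= t) (t_le_k : t <= k).
Local Notation cyc := (cycle_index k_gt0).
Implicit Types (S T : {set 'I_k}).

Lemma cyc_eq x y : (cyc x == cyc y) = (x == y %[mod k]).
Proof. by []. Qed.

Lemma cyc_small x y : x < k -> y < k -> (cyc x == cyc y) = (x == y).
Proof. by move=> xk yk; rewrite cyc_eq !modn_small. Qed.

Lemma cyc_ord (x : 'I_k) : cyc x = x.
Proof. by apply/val_inj; rewrite /= modn_small. Qed.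

Lemma cyc_addk x : cyc (x + k) = cyc x.
Proof. by apply/val_inj; rewrite /= modnDr. Qed.

Lemma cyc_shift x u : 0 < u < k -> cyc (x + u) != cyc x.
Proof.
move=> /andP[u0 uk]; rewrite cyc_eq -{2}[x]addn0 eqn_modDl mod0n modn_small //.
by rewrite -lt0n.
Qed.

(** Intervals are read in the [k]-periodic set of naturals attached to [S] by
    [cycle_index], so they may wrap around; by periodicity it is enough to let
    them start below [k] ([goodP]). *)
Definition good S := [forall x : 'I_k, [exists u : 'I_t, cyc (x + u) \in S]].

Lemma goodP S : reflect (forall x, exists2 u, u < t & cyc (x + u) \in S) (good S).
Proof.
apply: (iffP forallP) => [gS x|gS x]; last first.
  by have [u ut uS] := gS x; apply/existsP; exists (Ordinal ut).
have /existsP[u uS] := gS (cyc x); exists (val u); first exact: ltn_ord.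
suff -> : cyc (x + u) = cyc (cyc x + u) by [].
by apply/val_inj; rewrite /= modnDml.
Qed.

Lemma good_sub S T : S \subset T -> good S -> good T.
Proof.
move=> /subsetP ST /goodP gS; apply/goodP => x; have [u ut /ST uT] := gS x.
by exists u.
Qed.

Definition lo S := find (fun x => cyc x \in S) (iota 0 k).

Lemma lo_spec S a :
  a < k -> cyc a \in S -> (forall x, x < a -> cyc x \notin S) -> lo S = a.
Proof.
move=> ak aS lt_a.
have hasS : has (fun x => cyc x \in S) (iota 0 k).
  by apply/hasP; exists a; rewrite ?mem_iota.
have lok : lo S < k by rewrite -[X in _ < X](size_iota 0) -has_find.
have := nth_find 0 hasS; rewrite -/(lo S) nth_iota // add0n => loS.
apply/eqP; rewrite eqn_leq; apply/andP; split; rewrite leqNgt; apply/negP => lt.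
  by have := before_find 0 lt; rewrite nth_iota // add0n aS.
by have := lt_a _ lt; rewrite loS.
Qed.

Lemma loP S : good S ->
  [/\ lo S < t, cyc (lo S) \in S & forall x, x < lo S -> cyc x \notin S].
Proof.
move=> /goodP /(_ 0) [u ut]; rewrite add0n => uS.
have [a aS mina] := @ex_minnP (fun x => cyc x \in S) (ex_intro _ u uS).
have au : a <= u by apply: mina.
have at_ : a < t by apply: leq_ltn_trans ut.
have -> : lo S = a.
  apply: lo_spec => // [|x xa]; first exact: leq_trans t_le_k.
  by apply/negP => /mina; rewrite leqNgt xa.
by split=> // x xa; apply/negP => /mina; rewrite leqNgt xa.
Qed.

(** With [a] the least element of [S], the pattern followed by the matching
    consists of the anchors [a + q (t + 1)] and of the posts [a + q (t + 1) + 1]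
    just after them. *)
Definition post S q := lo S + q * t.+1 + 1.

(** The pattern goes on past its [q]-th post.  In a good set the gap after that post
    is then exactly [t], so that the next anchor is present as well ([mem_anchor]). *)
Definition block S q :=
  (cyc (post S q) \in S) && [forall u : 'I_t, (0 < u) ==> (cyc (post S q + u) \notin S)].

Lemma blockP S q : reflect
  (cyc (post S q) \in S /\ forall u, 0 < u < t -> cyc (post S q + u) \notin S)
  (block S q).
Proof.
apply: (iffP andP) => -[pS gap]; split=> //.
  move/forallP: gap => gap.
  by move=> u /andP[u0 ut]; have := gap (Ordinal ut); rewrite /= u0.
by apply/forallP => u; apply/implyP => u0; apply: gap; rewrite u0 ltn_ord.
Qed.

(** Reaching [k] counts as a halt, since a post beyond [k] cannot be toggled without
    touching the beginning of the pattern. *)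
Definition halts S q := (k <= post S q) || ~~ block S q.

Definition reach S := find (halts S) (iota 0 k.+1).

Lemma reachP S : [/\ reach S <= k, halts S (reach S) &
  forall q, q < reach S -> post S q < k /\ block S q].
Proof.
have hasS : has (halts S) (iota 0 k.+1).
  apply/hasP; exists k; first by rewrite mem_iota /= ltnS.
  by rewrite /halts /post; apply/orP; left; nia.
have rk : reach S < k.+1 by rewrite -[X in _ < X](size_iota 0) -has_find.
have := nth_find 0 hasS; rewrite -/(reach S) nth_iota // add0n => rS; split=> // q qr.
have := before_find 0 qr; rewrite nth_iota ?add0n; last exact: ltn_trans rk.
by move/negbT; rewrite negb_or negbK -ltnNge => /andP.
Qed.

Lemma reach_spec S q : q <= k -> halts S q ->
  (forall q', q' < q -> ~~ halts S q') -> reach S = q.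
Proof.
move=> qk hq lt_q; have [_ hr ltr] := reachP S.
apply/eqP; rewrite eqn_leq; apply/andP; split; rewrite leqNgt; apply/negP => lt.
  by have [pk bq] := ltr _ lt; move: hq; rewrite /halts bq orbF leqNgt pk.
by have := lt_q _ lt; rewrite hr.
Qed.

(** The element toggled by the matching, meaningful when
    [post S (reach S) < k]. *)
Definition pivot S := cyc (post S (reach S)).

(** A good set meets the [t] positions after a post; a block leaves only the
    last of them, and this is the next anchor. *)
Lemma mem_anchor S q : good S -> q <= reach S -> cyc (lo S + q * t.+1) \in S.
Proof.
move=> gS; have [lot loS _] := loP gS; case: q => [|q] qr; first by rewrite mul0n addn0.
have [_ _ /(_ _ qr)[_ /blockP[_ gap]]] := reachP S.
have [u ut] := goodP _ gS (post S q + 1).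
case: (ltnP u t.-1) => ut1.
  have : 0 < u.+1 < t by lia.
  by move/gap; rewrite -addn1 -addnA [1 + u]addnC addn1 => /negPf -> .
congr (cyc _ \in S); rewrite /post; nia.
Qed.

Lemma lo_toggle S T c : good S -> lo S < c < k ->
  (forall y, y < k -> y != c -> (cyc y \in T) = (cyc y \in S)) -> lo T = lo S.
Proof.
move=> gS /andP[loc ck] eqST; have [lot loS lo_min] := loP gS.
apply: lo_spec => [||x xlo]; first by lia.
  by rewrite eqST //; lia.
rewrite eqST; first exact: lo_min.
all: lia.
Qed.

(** Toggling the pivot changes neither the least element nor the blocks before the
    pivot, which lie to its left.  The halt also persists: if the pivot was absent,
    some element among its [t - 1] successors is present by goodness, so adding the
    pivot does not create a block. *)
Lemma reach_toggle S T : good S -> good T ->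
  post S (reach S) < k ->
  (forall y, y < k -> y != post S (reach S) -> (cyc y \in T) = (cyc y \in S)) ->
  lo T = lo S /\ reach T = reach S.
Proof.
move=> gS gT ck eqST; have [rk hr ltr] := reachP S.
have loE : lo T = lo S.
  by apply: lo_toggle eqST => //; rewrite ck andbT /post; lia.
have eqC z : cyc z != cyc (post S (reach S)) -> (cyc z \in T) = (cyc z \in S).
  rewrite -(cyc_ord (cyc z)) => nz; apply: eqST; first exact: ltn_ord.
  by apply: contraNneq nz => ->.
have postE q : post T q = post S q by rewrite /post loE.
split=> //; apply: reach_spec => // [|q qr].
  rewrite /halts postE leqNgt ck /=; apply/negP => /blockP[pT gap].
  rewrite postE in pT gap.
  have cS : cyc (post S (reach S)) \in S.
    apply/negPn/negP => cS; have [u ut uS] := goodP _ gS (post S (reach S)).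
    case: (posnP u) => u0; first by rewrite u0 addn0 (negPf cS) in uS.
    have := gap u; rewrite u0 ut => /(_ isT)/negP; apply.
    by rewrite eqC // cyc_shift // u0 (leq_trans ut).
  move: hr; rewrite /halts leqNgt ck /= => /negP; apply; apply/blockP; split=> // u ut.
  by have := gap u ut; rewrite eqC // cyc_shift //; lia.
have [qk /blockP[qS gap]] := ltr _ qr.
have lt_c u : u < t -> post S q + u < post S (reach S) by rewrite /post; nia.
rewrite /halts postE negb_or -ltnNge qk negbK /=; apply/blockP; rewrite postE; split.
  by rewrite eqST //; have := lt_c 0; rewrite addn0; lia.
move=> u /andP[u0 ut]; rewrite eqST ?gap ?u0 //; have := lt_c u ut; lia.
Qed.

Definition up := [set S | [&& good S, post S (reach S) < k & pivot S \in S]].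
Definition down := [set S | [&& good S, post S (reach S) < k & pivot S \notin S]].

Lemma good_up S : S \in up -> good S. Proof. by rewrite inE => /and3P[]. Qed.
Lemma good_down S : S \in down -> good S. Proof. by rewrite inE => /and3P[]. Qed.

(** Removing the pivot keeps the set good: an interval of length [t] through it
    contains the anchor just before it, or starts at the pivot and then
    contains one of the [t - 1] following elements, which are not all absent since
    the pivot is not the start of a block. *)
Lemma pivot_up S : S \in up ->
  [/\ pivot S \in S, S :\ pivot S \in down & pivot (S :\ pivot S) = pivot S].
Proof.
rewrite inE => /and3P[gS ck pS].
have [rk hr ltr] := reachP S.
have gT : good (S :\ pivot S).
  apply/goodP => x; have [u ut uS] := goodP _ gS x.
  have [upiv|upiv] := eqVneq (cyc (x + u)) (pivot S); last first.
    by exists u => //; rewrite !inE upiv.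
  case: u => [|u] in ut uS upiv *.
    move: hr; rewrite /halts leqNgt ck /= /block -/(pivot S) pS /= negb_forall.
    case/existsP=> v; rewrite negb_imply negbK => /andP[v0 vS].
    exists v => //.
    have -> : cyc (x + v) = cyc (post S (reach S) + v).
      apply/eqP; rewrite cyc_eq eqn_modDr; rewrite addn0 in upiv.
      by have /eqP := upiv; rewrite /pivot cyc_eq.
    by rewrite !inE vS andbT cyc_shift // v0 (leq_trans (ltn_ord v)).
  exists u; first exact: ltnW.
  have -> : cyc (x + u) = cyc (lo S + reach S * t.+1).
    apply/eqP; rewrite cyc_eq -(eqn_modDr 1) -addnA addn1.
    by have /eqP := upiv; rewrite /pivot cyc_eq.
  rewrite !inE mem_anchor // andbT eq_sym /pivot /post cyc_shift //; lia.
have [] := @reach_toggle S (S :\ pivot S) gS gT ck.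
  move=> y yk yc; rewrite !inE /pivot cyc_small //.
  by rewrite yc.
move=> loE rE; have pE : pivot (S :\ pivot S) = pivot S by rewrite {1}/pivot /post loE rE.
by split=> //; rewrite inE gT pE !inE eqxx /post loE rE ck.
Qed.

Lemma pivot_down S : S \in down ->
  [/\ pivot S \notin S, pivot S |: S \in up & pivot (pivot S |: S) = pivot S].
Proof.
rewrite inE => /and3P[gS ck pS].
have gT : good (pivot S |: S) by apply: good_sub gS; rewrite subsetU1.
have [] := @reach_toggle S (pivot S |: S) gS gT ck.
  by move=> y yk yc; rewrite !inE /pivot cyc_small // (negPf yc).
move=> loE rE; have pE : pivot (pivot S |: S) = pivot S by rewrite {1}/pivot /post loE rE.
by split=> //; rewrite inE gT pE !inE eqxx /post loE rE ck.
Qed.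

(** The lexicographic order on [(lo, reach)], as [reach S <= k]. *)
Definition weight S := lo S * k.+1 + reach S.

(** Let [W] be the common set.  It has the least element and the reach of [T].
    If [lo W] is [lo S], every block of [S] is a block of [W]: its gap remains, and
    goodness of [W] then requires its post.  So the pair does not decrease, and
    if it is unchanged, the pivots of [S] and [W] agree; as the pivot of [W] is not
    in [W], it is the element that was removed from [S]. *)
Lemma weight_incr S T x : S \in up -> T \in up -> x \in S ->
  S :\ x = T :\ pivot T -> S = T \/ weight S < weight T.
Proof.
move=> upS upT xS E; have gS := good_up upS; have gT := good_up upT.
have [pT downW pE] := pivot_up upT; have gW := good_down downW.
set W := T :\ pivot T in E downW pE gW.
have [loE rE] : lo W = lo T /\ reach W = reach T.
  move: (upT); rewrite inE => /and3P[_ ck _]; apply: reach_toggle => // y yk yc.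
  by rewrite !inE /pivot cyc_small // yc.
rewrite /weight -loE -rE.
have WS : {subset W <= S} by move=> y; rewrite -E !inE => /andP[].
have [_ _ lo_min] := loP gS; have [_ loW _] := loP gW.
have [rkS hS ltS] := reachP S; have [rkW hW ltW] := reachP W.
have [lt|lt|lo_eq] := ltngtP (lo S) (lo W).
- right; nia.
- by have := lo_min _ lt; rewrite WS.
have postE q : post W q = post S q by rewrite /post lo_eq.
have [lt|lt|r_eq] := ltngtP (reach S) (reach W).
- right; nia.
- have [ck /blockP[_ gap]] := ltS _ lt.
  move: hW; rewrite /halts postE leqNgt ck /= => /negP[]; apply/blockP.
  rewrite postE; split; last by move=> u /gap; apply: contra => /WS.
  have [u ut uW] := goodP _ gW (post S (reach W)).
  case: (posnP u) => u0; first by rewrite u0 addn0 in uW.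
  by have := gap u; rewrite u0 ut (WS _ uW) => /(_ isT).
left; have pSW : pivot W = pivot S by rewrite /pivot postE r_eq.
have xp : x = pivot S.
  apply/eqP/negPn/negP => nx.
  have : pivot S \in W.
    by rewrite -E !inE eq_sym nx; move: upS; rewrite inE => /and3P[].
  by rewrite -pSW; move: downW; rewrite inE => /and3P[_ _ /negPf ->].
by rewrite -(setD1K xS) E xp -pSW pE setD1K.
Qed.

Lemma critical_post S : good S -> (S \notin up :|: down) = (k <= post S (reach S)).
Proof.
move=> gS; rewrite !inE gS /=; case: ltnP => //= _.
by case: (_ \in S).
Qed.

(** The pattern starting at [a], cut at [k]. *)
Definition crit_set (a : nat) : {set 'I_k} :=
  [set y : 'I_k | (a <= y) && ((y - a) %% t.+1 <= 1)].

Lemma crit_setE a y : y < k ->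
  (cyc y \in crit_set a) = (a <= y) && ((y - a) %% t.+1 <= 1).
Proof. by move=> yk; rewrite inE /= modn_small. Qed.

Lemma critical_shape S : good S -> k <= post S (reach S) -> S = crit_set (lo S).
Proof.
move=> gS kc; have [lot loS lo_min] := loP gS; have [rk _ ltr] := reachP S.
apply/setP => y; rewrite -(cyc_ord y) crit_setE //.
have yk := ltn_ord y; move: (nat_of_ord y) yk => {}y yk.
case: leqP => [ley|]; last by move/lo_min/negPf.
rewrite /=; have yE : y = lo S + (y - lo S) %/ t.+1 * t.+1 + (y - lo S) %% t.+1.
  by rewrite -addnA -divn_eq subnKC.
have em : (y - lo S) %% t.+1 < t.+1 by rewrite ltn_mod.
move: (_ %/ _) (_ %% _) yE em => q e yE em.
have [qr|rq] := ltnP q (reach S).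
  have [ck /blockP[pS gap]] := ltr _ qr.
  case: (ltngtP e 1) => [e0|e2|e1].
  - have e_0 : e = 0 by lia.
    rewrite yE e_0 addn0; exact: mem_anchor gS (ltnW qr).
  - have -> : y = post S q + e.-1 by rewrite /post; lia.
    by apply/negbTE/gap; lia.
  - by rewrite yE e1.
have [qE e0] : q = reach S /\ e = 0 by rewrite /post in kc; nia.
by rewrite yE e0 addn0 qE mem_anchor.
Qed.

Variables p d : nat.
Hypotheses (k_eq : k = p * t.+1 + d) (d_le_t : d <= t).

(** If the first missing post is [k] itself, the last anchor is [k - 1], so that
    [k = a + 1] modulo [t + 1].  Otherwise the gap of length [t] after the last post
    ends at [k] or beyond, and it must end exactly at [a + k], so that [t + 1]
    divides [k]. *)
Lemma critical_residue S : good S -> k <= post S (reach S) -> d = 0 \/ d = (lo S).+1.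
Proof.
move=> gS kc; have [lot loS lo_min] := loP gS; have [rk _ ltr] := reachP S.
have kmod : k %% t.+1 = d by rewrite k_eq modnMDl modn_small.
move: kc; rewrite leq_eqVlt => /orP[/eqP kE|kc].
  by right; rewrite -kmod kE /post addn1 -addSn addnC modnMDl modn_small.
left; case rE: (reach S) kc => [|q] kc; first by rewrite /post in kc; lia.
have qr : q < reach S by rewrite rE.
have [ck /blockP[pS gap]] := ltr _ qr.
have anchor := mem_anchor gS (leqnn (reach S)); rewrite rE in anchor.
have [y yE] : exists y, lo S + q.+1 * t.+1 = y + k.
  by exists (lo S + q.+1 * t.+1 - k); rewrite subnK //; rewrite /post in kc; lia.
rewrite yE cyc_addk in anchor.
have loy : lo S <= y by rewrite leqNgt; apply/negP => /lo_min; rewrite anchor.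
have [//|lty] := leqP y (lo S).
  move=> yle; have yl : y = lo S by lia.
  by rewrite -kmod (_ : k = q.+1 * t.+1) ?modnMl //; lia.
have := gap (lo S + k - post S q); rewrite subnKC; last by lia.
rewrite cyc_addk loS => /(_ _)/negP; case=> //.
by rewrite /post in ck *; lia.
Qed.

(** The least elements of the critical sets. *)
Definition crit_start a := if d == 0 then a < t else a == d.-1.

Lemma crit_start_lt a : crit_start a -> a < t.
Proof. by rewrite /crit_start; case: eqP => // _ /eqP ->; lia. Qed.

(** When [t + 1] divides [k] the pattern closes up: for [y < a] the remainder of
    [y - a] modulo [t + 1] is at least [2], because [a < t], so that the
    positions before [a] fall into the gap that wraps around. *)
Lemma crit_setE_cyclic a y : d = 0 -> a < t ->
  (cyc y \in crit_set a) = ((y + k - a) %% t.+1 <= 1).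
Proof.
move=> d0 lt_at; have kE : k = p * t.+1 by rewrite k_eq d0 addn0.
rewrite [y](divn_eq y k); have y0k : y %% k < k by rewrite ltn_mod.
move: (y %/ k) (y %% k) y0k => Q z zk.
have -> : cyc (Q * k + z) = cyc z by apply/eqP; rewrite cyc_eq modnMDl.
have -> : Q * k + z + k - a = Q * p * t.+1 + (z + k - a) by rewrite kE -mulnA; lia.
rewrite crit_setE // modnMDl; case: leqP => [az|za] /=.
  by rewrite [in RHS]kE addnC -addnBA // modnMDl.
apply/esym/negbTE; rewrite -ltnNge.
have -> : z + k - a = p.-1 * t.+1 + (t.+1 - (a - z)).
  have : 0 < p by case: (p) kE k_gt0 => // ->.
  by case: (p) kE => // p' -> _; rewrite mulSn /=; lia.
by rewrite modnMDl modn_small; lia.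
Qed.

Lemma lo_crit_set a : crit_start a -> lo (crit_set a) = a.
Proof.
move=> /crit_start_lt at_; apply: lo_spec => [||x xa].
- exact: leq_trans t_le_k.
- by rewrite crit_setE ?leqnn ?subnn //; lia.
- by rewrite crit_setE; lia.
Qed.

Lemma crit_set_good a : crit_start a -> good (crit_set a).
Proof.
move=> ca; have at_ := crit_start_lt ca.
move: ca; rewrite /crit_start; case: eqP => [d0 _|/eqP d0 /eqP aE].
  apply/goodP => x; have e_lt : (x + k - a) %% t.+1 < t.+1 by rewrite ltn_mod.
  have xE := divn_eq (x + k - a) t.+1.
  move: (_ %/ _) (_ %% _) xE e_lt => q e xE e_lt.
  have [e1|e2] := leqP e 1.
    by exists 0; [lia|rewrite crit_setE_cyclic // addn0 xE modnMDl modn_small //; lia].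
  (* the distance from [x] to the next anchor *)
  exists (t.+1 - e); first by lia.
  rewrite crit_setE_cyclic // (_ : _ - a = q.+1 * t.+1) ?modnMl //; lia.
apply/forallP => x; apply/existsP.
have xk := ltn_ord x; case: (ltnP x a) => xa.
  have ut : a - x < t by lia.
  exists (Ordinal ut); rewrite /= subnKC 1?ltnW // crit_setE; last by lia.
  by rewrite leqnn subnn.
have e_lt : (x - a) %% t.+1 < t.+1 by rewrite ltn_mod.
have xE := divn_eq (x - a) t.+1.
move: (_ %/ _) (_ %% _) xE e_lt => q e xE e_lt.
have [e1|e2] := leqP e 1.
  have t0 : 0 < t by lia.
  exists (Ordinal t0); rewrite /= addn0 crit_setE // xa xE modnMDl modn_small //; lia.
have ut : t.+1 - e < t by lia.
have qp : q < p by nia.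
have yE : x + (t.+1 - e) = a + q.+1 * t.+1 by lia.
exists (Ordinal ut); rewrite /= yE crit_setE; last by nia.
by rewrite leq_addr addKn modnMl.
Qed.

Lemma crit_set_critical a : crit_start a -> crit_set a \notin up :|: down.
Proof.
move=> ca; rewrite critical_post; last exact: crit_set_good.
have at_ := crit_start_lt ca; have loE := lo_crit_set ca.
rewrite leqNgt; apply/negP => ck; have [_ + _] := reachP (crit_set a).
rewrite /halts leqNgt ck /= => /negP; apply; apply/blockP.
move: (reach _) ck => q; rewrite /post loE => ck; split.
  rewrite crit_setE // -addnA leq_addr addKn modnMDl modn_small //; lia.
move=> u /andP[u0 ut].
have e2 : ((q * t.+1 + u.+1) %% t.+1 <= 1) = false by rewrite modnMDl modn_small; lia.
move: ca; rewrite /crit_start; case: eqP => [d0 _|/eqP d0 /eqP aE].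
  rewrite crit_setE_cyclic //.
  have -> : a + q * t.+1 + 1 + u + k - a = p * t.+1 + (q * t.+1 + u.+1) by lia.
  by rewrite modnMDl e2.
rewrite crit_setE.
  have -> : a + q * t.+1 + 1 + u - a = q * t.+1 + u.+1 by lia.
  by rewrite e2 andbF.
have : q < p by nia.
nia.
Qed.

(** The elements are enumerated as [a + (j / 2) (t + 1) + (j mod 2)]. *)
Lemma card_crit_set a : crit_start a -> #|crit_set a| = 2 * p + (d != 0).
Proof.
move=> ca; have at_ := crit_start_lt ca.
pose f (j : 'I_(2 * p + (d != 0))) := a + j %/ 2 * t.+1 + j %% 2.
have f_lt j : f j < k.
  rewrite /f; have := ltn_ord j; move: (nat_of_ord j) => {}j jr.
  have jE := divn_eq j 2; have j2 : j %% 2 < 2 by rewrite ltn_mod.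
  move: (j %/ 2) (j %% 2) jE j2 => q e jE e2.
  move: ca; rewrite /crit_start; case: eqP jr => [d0 jr _|/eqP d0 jr /eqP aE].
    have : q < p by lia.
    nia.
  have [qp|qp] := ltnP q p; first by nia.
  have [-> ->] : q = p /\ e = 0 by lia.
  lia.
have f_div j : (f j - a) %/ t.+1 = j %/ 2 /\ (f j - a) %% t.+1 = j %% 2.
  have lt1 : j %% 2 < t.+1 by have := ltn_mod j 2; lia.
  by rewrite /f -addnA addKn divnMDl // modnMDl (modn_small lt1) (divn_small lt1) addn0.
have f_inj : injective (fun j => cyc (f j)).
  move=> i j /eqP; rewrite cyc_small // => /eqP E; apply/val_inj => /=.
  have [qi ei] := f_div i; have [qj ej] := f_div j.
  by rewrite (divn_eq i 2) (divn_eq j 2) -qi -ei -qj -ej E.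
rewrite -[RHS]card_ord -(card_imset _ f_inj); apply: eq_card => y.
rewrite -(cyc_ord y) crit_setE //; have yk := ltn_ord y.
apply/andP/imsetP => [[ay ym]|[j _ /eqP]]; last first.
  rewrite cyc_small // => /eqP ->; have [_ ->] := f_div j.
  by rewrite /f -addnA leq_addr -ltnS ltn_mod.
have yE := divn_eq (y - a) t.+1.
move: (_ %/ _) (_ %% _) yE ym => q e yE e1.
have jr : 2 * q + e < 2 * p + (d != 0).
  move: ca; rewrite /crit_start; case: eqP => [d0 _|/eqP d0 /eqP aE] /=.
    have : q < p by nia.
    lia.
  have [qp|qp] := ltnP q p; first by lia.
  have : q = p by nia.
  move=> ?; subst q; lia.
exists (Ordinal jr) => //; congr cyc; rewrite /f /=.
have [-> ->] : (2 * q + e) %/ 2 = q /\ (2 * q + e) %% 2 = e by lia.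
lia.
Qed.

Lemma critical_card S : good S -> S \notin up :|: down -> #|S| = 2 * p + (d != 0).
Proof.
move=> gS; rewrite critical_post // => kc; have [lot _ _] := loP gS.
rewrite [S]critical_shape //; apply: card_crit_set; rewrite /crit_start.
case: eqP => [//|dn0]; case: (critical_residue gS kc) => [/dn0 //|dE].
by rewrite [d in d.-1]dE.
Qed.

Lemma card_critical :
  #|[set S | good S & S \notin up :|: down]| = if d == 0 then t else 1.
Proof.
have [d0|dn0] := eqVneq d 0.
  have inj : injective (fun a : 'I_t => crit_set a).
    by move=> a b /(congr1 lo); rewrite !lo_crit_set ?/crit_start ?d0 //= => /val_inj.
  rewrite -[RHS]card_ord -(card_imset _ inj); apply: eq_card => S; rewrite [LHS]inE.
  apply/andP/imsetP => [[gS]|[a _ ->]].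
    rewrite critical_post // => kc; have [lot _ _] := loP gS.
    by exists (Ordinal lot) => //; apply: critical_shape.
  have ca : crit_start a by rewrite /crit_start d0 /=.
  by split; [apply: crit_set_good|apply: crit_set_critical].
have ca : crit_start d.-1 by rewrite /crit_start (negPf dn0).
rewrite -(cards1 (crit_set d.-1)); apply: eq_card => S; rewrite [LHS]inE [RHS]inE.
apply/andP/eqP => [[gS]|->]; last first.
  by split; [apply: crit_set_good|apply: crit_set_critical].
rewrite critical_post // => kc; rewrite [LHS]critical_shape //.
by case: (critical_residue gS kc) => dE; [rewrite dE in dn0|rewrite dE].
Qed.

End CyclicMatching.

(** * Path ideals of cycles *)

Lemma modn_block l k A f : f < l -> (A * l + f) %% (k * l) = (A %% k) * l + f.
Proof.
move=> fl; case: (posnP k) => [->|k0]; first by rewrite mul0n !modn0.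
have wk : A %% k < k by rewrite ltn_mod.
rewrite {1}(divn_eq A k) mulnDl -mulnA -addnA modnMDl modn_small //; nia.
Qed.

Section PathIdeal.
Variables (l m n s t k : nat) (l_gt0 : 0 < l) (n_gt0 : 0 < n) (k_gt0 : 0 < k).
Hypotheses (n_eq : n = k * l) (m_eq : m = t * l + s) (s_lt_l : s < l) (m_le_n : m <= n).

(** Exponent of the monomial of the [i]-th path; it takes values in [0] and [1]
    because a path has at most [n] vertices ([path_exponentE]). *)
Definition path_exponent (i : 'I_k) : 'X_{1..n} :=
  (\sum_(j < m) U_(cycle_index n_gt0 (i * l + j)))%MM.

Lemma path_monomialE (K : fieldType) (i : 'I_k) :
  path_monomial K n_gt0 m l i = 'X_[path_exponent i]%R.
Proof. exact: mprodXE. Qed.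

Definition on_path (i : 'I_k) (v : 'I_n) :=
  [exists j : 'I_m, cycle_index n_gt0 (i * l + j) == v].

Lemma path_exponentE i v : path_exponent i v = on_path i v.
Proof.
rewrite mnm_sumE; under eq_bigr => j _ do rewrite mnm1E.
rewrite /on_path; case: existsP => [[j /eqP jv]|none]; last first.
  rewrite big1 // => j _; apply/eqP; rewrite eqb0; apply/negP => jv.
  by apply: none; exists j.
rewrite (bigD1 j) //= jv eqxx big1 // => j' nj; apply/eqP; rewrite eqb0 -jv.
apply: contraNneq nj => /(congr1 val) /= /eqP; rewrite eqn_modDl.
by rewrite !modn_small ?(leq_trans (ltn_ord _) m_le_n).
Qed.

Lemma mdeg_mlcm_full (S : {set 'I_k}) :
  reflect (forall v, exists2 i, i \in S & on_path i v)
    (mdeg (mlcm_set path_exponent S) == n).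
Proof.
have cE v : mlcm_set path_exponent S v = [exists i in S, on_path i v].
  rewrite mnmE; under eq_bigr => i _ do rewrite path_exponentE.
  case: existsP => [[i /andP[iS iv]]|none]; last first.
    rewrite big1 // => i iS; apply/eqP; rewrite eqb0; apply/negP => iv.
    by apply: none; exists i; rewrite iS.
  apply/eqP; rewrite eqn_leq; apply/andP; split.
    by apply/bigmax_leqP => i' _; apply: leq_b1.
  by rewrite (bigD1 i) //= iv leq_max.
rewrite mdegE; under eq_bigr => v _ do rewrite cE.
rewrite -big_mkcond sum1_card; apply: (iffP eqP) => [full v|full].
  have /eqP full' : [set v | [exists i in S, on_path i v]] == setT.
    by rewrite eqEcard subsetT cardsT card_ord cardsE full leqnn.
  have : v \in [set: 'I_n] by rewrite inE.
  by rewrite -full' inE => /existsP[i /andP[]]; exists i.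
rewrite -[RHS]card_ord; apply: eq_card => v; rewrite !inE.
by apply/existsP; have [i iS iv] := full v; exists i; rewrite iS.
Qed.

(** Position [f] of block [c] is reached by the [i]-th path after [u] full blocks
    and [f] further steps. *)
Lemma on_pathP (i : 'I_k) c f : f < l -> forall vn : c * l + f < n,
  on_path i (Ordinal vn) = [exists u : 'I_t.+1, (u * l + f < m) && ((i + u) %% k == c)].
Proof.
move=> fl vn; have ck : c < k by nia.
apply/existsP/existsP => [[j /eqP/(congr1 val) /=]|[u /andP[um /eqP uc]]].
  have jm := ltn_ord j; have jE := divn_eq j l; have rl : j %% l < l by rewrite ltn_mod.
  move: (j %/ l) (j %% l) jE rl => u r jE rl.
  rewrite jE addnA -mulnDl n_eq modn_block // => E.
  have ut : u < t.+1 by nia.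
  have wk : (i + u) %% k < k by rewrite ltn_mod.
  have rf : r = f.
    have := congr1 (fun x => x %% l) E.
    by rewrite !modnMDl !modn_small.
  subst r; exists (Ordinal ut); rewrite /= -jE jm /=.
  by move: E => /eqP; rewrite eqn_add2r eqn_pmul2r.
exists (Ordinal um); apply/eqP/val_inj => /=.
by rewrite addnA -mulnDl n_eq modn_block // uc.
Qed.

(** A set of paths covering the last position of each block [c] contains a path
    starting at one of [c - t + 1, ..., c], as the [s < l] extra vertices of a path
    stop short of a last position.  Conversely these paths contain the whole block [c]. *)
Lemma mdeg_mlcm_good (S : {set 'I_k}) : 0 < t -> t <= k ->
  (mdeg (mlcm_set path_exponent S) == n) = good t k_gt0 S.
Proof.
move=> t_gt0 t_le_k.
apply/mdeg_mlcm_full/goodP => [full y|gS v].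
  (* the last block of the interval starting at [y] *)
  pose c := (y + t.-1) %% k; have ck : c < k by rewrite ltn_mod.
  have vn : c * l + l.-1 < n by nia.
  have l1 : l.-1 < l by lia.
  have [i iS] := full (Ordinal vn); rewrite on_pathP // => /existsP[u /andP[um /eqP uc]].
  have ut : u < t by nia.
  exists (t.-1 - u); first by lia.
  suff -> : cycle_index k_gt0 (y + (t.-1 - u)) = i by [].
  rewrite -[RHS](cyc_ord k_gt0); apply/eqP; rewrite cyc_eq -(eqn_modDr u) uc.
  by rewrite -addnA subnK ?modn_mod //; lia.
have vE := divn_eq v l; have fl : v %% l < l by rewrite ltn_mod.
have vn := ltn_ord v.
move: (v %/ l) (v %% l) vE fl => c f vE fl; rewrite vE in vn.
(* the interval of [t] residues ending at [c], translated by [k] *)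
have [u ut uS] := gS (c + (k - t.-1)).
exists (cycle_index k_gt0 (c + (k - t.-1) + u)) => //.
have -> : v = Ordinal vn by apply/val_inj.
rewrite on_pathP //; apply/existsP.
have ut' : t.-1 - u < t.+1 by lia.
exists (Ordinal ut'); rewrite /= modnDml; apply/andP; split; first by nia.
have -> : c + (k - t.-1) + u + (t.-1 - u) = c + k by lia.
by rewrite modnDr modn_small //; nia.
Qed.

End PathIdeal.

Theorem theorem5p1 (K : fieldType) (l m n s t k p d : nat)
  (l_gt0 : (0 < l)%N) (n_gt0 : (0 < n)%N)
  (m_ge2 : (2 <= m)%N) (m_le_n : (m <= n)%N)
  (l_dvd_n : (l %| n)%N)
  (l_le_m1 : (l <= m - 1)%N) (l_le_half : (2 * l <= n)%N)
  (s_lt_l : (s < l)%N) (m_mod_l : m = s %[mod l])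
  (t_def : t = ((m - s) %/ l)%N) (k_def : k = (n %/ l)%N)
  (t_ge2 : (2 <= t)%N)
  (k_eq : k = (p * (t + 1) + d)%N) (d_le_t : (d <= t)%N)
  (F : graded_free_seq K n)
  (F_res : minimal_graded_free_resolution (path_ideal (K := K) n_gt0 m l) F)
  (i : nat) :
  graded_betti F i n =
    (if (d == 0) && (i == 2 * p) then t
     else if (d != 0) && (i == 2 * p + 1) then 1
     else 0)%N.
Proof.
have n_eq : n = (k * l)%N by rewrite k_def divnK.
have m_eq : m = (t * l + s)%N.
  move: m_mod_l; rewrite (modn_small s_lt_l) => ms.
  have mE := divn_eq m l; rewrite ms in mE.
  by rewrite t_def {2}mE addnK mulnK.
have t_le_k : (t <= k)%N by rewrite -(leq_pmul2r l_gt0); lia.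
have k_gt0 : (0 < k)%N by lia.
have k_eq' : k = (p * t.+1 + d)%N by rewrite -addn1.
pose e := @path_exponent l m n k n_gt0.
have JE : path_ideal (K := K) n_gt0 m l =
    monomial_ideal (K := K) (@path_exponent l m n (n %/ l) n_gt0).
  rewrite /path_ideal /monomial_ideal; congr ideal_span.
  by apply: functional_extensionality => x; rewrite path_monomialE.
rewrite JE -k_def -/e in F_res.
have goodE S := @mdeg_mlcm_good l m n s t k l_gt0 n_gt0 k_gt0 n_eq m_eq s_lt_l m_le_n
  S (ltnW t_ge2) t_le_k.
rewrite (betti_matching (U := up t k_gt0) (D := down t k_gt0) (piv := pivot t k_gt0)
   (phi := weight t k_gt0) (e := e) _ _ _ _ _ (homogeneous_monomial_ideal K e)
   (taylor_resolution K e) F_res (i0 := 2 * p + (d != 0)))%N.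
- have -> : critical e n (up t k_gt0) (down t k_gt0) (2 * p + (d != 0)) =
      [set S | good t k_gt0 S & S \notin up t k_gt0 :|: down t k_gt0].
    apply/setP => S; rewrite in_setD [S \in strand_basis _ _ _]inE [RHS]inE goodE andbC.
    case gS: (good t k_gt0 S); rewrite ?andbF //= andbT.
    have [_|nS] := boolP (S \in _ :|: _); first by rewrite andbF.
    by rewrite (critical_card t_ge2 t_le_k k_eq' d_le_t gS nS) eqxx.
  rewrite (card_critical k_gt0 t_ge2 t_le_k k_eq' d_le_t).
  by case: (d == 0); rewrite ?addn0.
- by move=> S /good_up gS; apply/eqP; rewrite goodE.
- by move=> S /good_down gS; apply/eqP; rewrite goodE.
- exact: pivot_up.
- exact: pivot_down.
- exact: weight_incr.
move=> S /eqP; rewrite goodE; exact: critical_card.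
Qed.
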